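(* Let $M\ge 2$, let $S=\{i_1,\ldots,i_M\}\subset\mathbb{R}$ with $i_1<\cdots<i_M$, and let $\underline p=(p_1,\ldots,p_M)$ be a probability mass function over $S$ with $\min_j p_j>0$ and expected value $e_0=\sum_{j=1}^M i_jp_j$. Let $r\ge1$ be an integer. Then there exists $a_0\in[0,1)$ such that for each $a\in[a_0,1)$ the following holds. Let $\tau$ be a random time with $$\mathbb{P}(\tau=k)=\binom{r+k-1}{r-1}(1-a)^ra^k,\qquad k=0,1,2,\ldots$$ Then there exists $\underline q=(q_1,\ldots,q_M)\in\{0\}\times(0,1]^{M-2}\times\{0\}$ such that $P(\underline q)$ (see context) is the one step transition matrix of a Markov chain $X$ (a DMRW) with state space $S$, independent of $\tau$, such that $$\mathbb{P}(X_\tau=i_j\mid X_0=e_0)=p_j,\qquad j=1,\ldots,M.$$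
   Context: DMRW (discrete time Markov martingale random walk on the finite state space $S=\{i_1<\cdots<i_M\}$) with parameter vector $\underline q\in\{0\}\times[0,1]^{M-2}\times\{0\}$: a martingale that is a time homogeneous discrete time Markov process with one step transition matrix $P(\underline q)$, $P_{j,k}=\mathbb{P}(X_{t+1}=i_k\mid X_t=i_j)$, where $P_{j,j}=1-q_j$ for all $j$; for $2\le j\le M-1$, $P_{j,j-1}=q_j\frac{i_{j+1}-i_j}{i_{j+1}-i_{j-1}}$ and $P_{j,j+1}=q_j\frac{i_j-i_{j-1}}{i_{j+1}-i_{j-1}}$; and all other entries are $0$. If the initial value $y$ lies in $(i_{j-1},i_j)$, the process immediately jumps at time $0$ into $S$: $\mathbb{P}(X_{0+}=i_j\mid X_0=y)=\frac{y-i_{j-1}}{i_j-i_{j-1}}$, $\mathbb{P}(X_{0+}=i_{j-1}\mid X_0=y)=\frac{i_j-y}{i_j-i_{j-1}}$, and then evolves according to $P(\underline q)$. Consequently, with $i_{l-1}<e_0\le i_l$, $\mathbb{P}(X_\tau=i_j\mid X_0=e_0)$ means $\frac{e_0-i_{l-1}}{i_l-i_{l-1}}\mathbb{P}(X_\tau=i_j\mid X_0=i_l)+\frac{i_l-e_0}{i_l-i_{l-1}}\mathbb{P}(X_\tau=i_j\mid X_0=i_{l-1})$ (on $\{\tau=0\}$ the position is the one after the immediate jump). *)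

(* Defs.v *)
From HB Require Import structures.
From mathcomp Require Import all_boot all_order all_algebra.
From mathcomp Require Import all_classical all_reals all_analysis.
Set Implicit Arguments.
Unset Strict Implicit.
Unset Printing Implicit Defensive.
Import Order.TTheory GRing.Theory Num.Theory.
Import numFieldNormedType.Exports.
Local Open Scope classical_set_scope.
Local Open Scope ring_scope.

(* The state space is S = {s 0 < ... < s (M-1)}; indices are shifted by one
   with respect to i_1 < ... < i_M. *)

(* Neighbouring indices; [prv] fixes the first index, [nxt] the last one. *)
Definition prv (M : nat) (j : 'I_M) : 'I_M := insubd j j.-1.
Definition nxt (M : nat) (j : 'I_M) : 'I_M := insubd j j.+1.

Definition inner (M : nat) (j : 'I_M) : bool := (0 < j)%N && (j.+1 < M)%N.

Definition dmrw_matrix (R : realType) (M : nat) (s q : 'I_M -> R) : 'M[R]_M :=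
  \matrix_(j, k)
    if k == j then 1 - q j
    else if inner j && (k == prv j) then
      q j * ((s (nxt j) - s j) / (s (nxt j) - s (prv j)))
    else if inner j && (k == nxt j) then
      q j * ((s j - s (prv j)) / (s (nxt j) - s (prv j)))
    else 0.

(* Probability that a process with initial value y is at s j right after the
   immediate jump into S at time 0; there is no jump when y is in S. *)
Definition jump_prob (R : realType) (M : nat) (s : 'I_M -> R) (y : R)
    (j : 'I_M) : R :=
  if y == s j then 1
  else if (s (prv j) < y) && (y < s j) then
    (y - s (prv j)) / (s j - s (prv j))
  else if (s j < y) && (y < s (nxt j)) then
    (s (nxt j) - y) / (s (nxt j) - s j)
  else 0.

Section Processes.
Context {d : measure_display} {T : measurableType d} {R : realType}
  {P : probability T R}.

Definition cond_prob (A B : set T) : R := fine (P (A `&` B)) / fine (P B).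

(* Natural filtration sigma(Y_0, ..., Y_n). *)
Definition history (Y : nat -> {RV P >-> R}) (n : nat) : set (set T) :=
  g_sigma_preimage (fun m : 'I_n.+1 => (Y m : T -> R)).

Definition sigma_process (Y : nat -> {RV P >-> R}) : set (set T) :=
  <<s \bigcup_n preimage_set_system setT (Y n : T -> R) measurable >>.

(* E[Y_{n+1} | sigma(Y_0, ..., Y_n)] = Y_n, through the defining property of
   conditional expectation. *)
Definition martingale (Y : nat -> {RV P >-> R}) : Prop :=
  (forall n, P.-integrable setT (fun w => (Y n w)%:E)) /\
  (forall n A, history Y n A ->
     (\int[P]_(w in A) (Y n.+1 w)%:E = \int[P]_(w in A) (Y n w)%:E)%E).

(* The random time is independent of the whole process. *)
Definition independent_time (tau : {RV P >-> nat}) (Y : nat -> {RV P >-> R}) :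
    Prop :=
  forall A k, sigma_process Y A ->
    P (A `&` tau @^-1` [set k]) = (P A * P (tau @^-1` [set k]))%E.

(* A process with initial value X0 and later positions X 0, X 1, ... is put
   into a single sequence; X 0 is the position X_{0+}. *)
Definition with_start (X0 : {RV P >-> R}) (X : nat -> {RV P >-> R}) (n : nat) :
    {RV P >-> R} :=
  if n is m.+1 then X m else X0.

(* [dmrw_init] says that P(X_{0+} = s j | X_0) = jump_prob s X_0 j, for an
   initial value that may be random; [dmrw_markov] is the Markov property with
   respect to the natural filtration, with transition matrix P(q). *)
Record dmrw (M : nat) (s q : 'I_M -> R) (X0 : {RV P >-> R})
    (X : nat -> {RV P >-> R}) : Prop := {
  dmrw_range : forall w, exists j k, s j <= X0 w <= s k;
  dmrw_states : forall t w, exists j, X t w = s j;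
  dmrw_init : forall (B : set R) (j : 'I_M), measurable B ->
    P (X0 @^-1` B `&` X 0%N @^-1` [set s j]) =
    (\int[P]_(w in X0 @^-1` B) (jump_prob s (X0 w) j)%:E)%E;
  dmrw_markov : forall (t : nat) (A : set T) (j k : 'I_M),
    history (with_start X0 X) t.+1 A ->
    P (A `&` X t @^-1` [set s j] `&` X t.+1 @^-1` [set s k]) =
    (P (A `&` X t @^-1` [set s j]) * (dmrw_matrix s q j k)%:E)%E;
  dmrw_martingale : martingale (with_start X0 X)
}.

End Processes.
Arguments cond_prob {d T R} P A B.

(* Main.v *)
Require Import Defs.
From HB Require Import structures.
From mathcomp Require Import all_boot all_order all_algebra.
From mathcomp Require Import all_classical all_reals all_analysis.
From mathcomp Require Import zify ring lra.
Set Implicit Arguments.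
Unset Strict Implicit.
Unset Printing Implicit Defensive.
Import Order.TTheory GRing.Theory Num.Theory.
Import numFieldNormedType.Exports.

(** Write [P(q) = 1 + G(q)], where [G] is linear in [q], and put
[l = a q / (1 - a)].  Then [(1 - a) (1 - a P(q))^-1 = (1 - G(l))^-1], so the
generating function of the negative binomial law shows that, from the initial
law [mu] of the immediate jump, the law of the chain at the independent time is
[nu(l) = mu (1 - G(l))^-r].  It depends on [a] and [q] through [l] only, and
each [l >= 0] comes from some [q] in [[0, 1]] as soon as [a / (1 - a)] dominates
the entries of [l].  Hence it suffices to find a single [l], positive at the
inner states, with [nu(l) = p] ([exists_rates]); the threshold for [a] is then
read off from [l].

Finding [l] is a nonlinear complementarity problem: look for [l >= 0] such
that, at each inner state [j], [nu(l)_j <= p_j], with equality if [l_j > 0].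
A solution of it is what is wanted ([complementary_rate]).  Indeed if [l_j = 0]
the chain never leaves [j], so [(X - s_j)^+] keeps its initial mean
[(e0 - s_j)^+], which by Jensen is strictly below its mean under [p].  But
[p - nu(l)] has total mass 0 and mean 0 and is nonnegative at the inner states,
so that [p] gives convex functions at most the integral that [nu(l)] gives
them: a contradiction.  Thus all the inner [l_j] are positive, [nu(l)] and [p]
agree at the inner states, and mass and mean force them to agree at the two
ends as well.

The complementarity problem is solved by a fixed point argument on a cube
[[0, L]^M] ([complementarity]).  What makes it work is that [nu(l)_j < p_j]
when [l_j = L] is large: [l_j nu(l)_j] is bounded because the expectation of
[s^2] stays bounded ([law_after_bound]).  The combinatorial heart is the lemma
of Scarf ([scarf]), a parity argument in the style of Sperner's lemma which
needs no triangulation; applied to finer and finer grids in the cube it gives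
approximate solutions, and compactness gives an exact one.

The process is built from one uniform random variable ([stage]): a uniform [v]
selects the next state as a quantile of the current row of the transition
matrix, and the position of [v] inside the selected interval, rescaled, is
again uniform and independent of the past, hence can be used for the next
step ([residue_uniform]).  Placing the uniform variable on a second factor next
to the probability space of the time makes the process independent of the
time. *)

(** * The lemma of Scarf *)

(** A map that loses exactly one element merges exactly one pair [a], [b], and
these are the only elements that can be removed without shrinking the image.
The parity argument uses this twice: for colourings of sets, and for the map
from orders to the minima of a set. *)
Lemma imset_collision (T U : finType) (g : T -> U) (A : {set T}) :
  #|A| = #|g @: A|.+1 ->
  exists a b, [/\ a \in A, b \in A, a != b, g a = g b &
    [/\ {in A :\ a &, injective g}, {in A :\ b &, injective g} &
    forall x, x \in A -> (g @: (A :\ x) == g @: A) = (x \in [set a; b])]].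
Proof.
move=> cA.
have : ~~ [forall a in A, forall b in A, (g a == g b) ==> (a == b)].
  apply/negP => /forall_inP H.
  suff /imset_injP : {in A &, injective g} by rewrite cA; lia.
  move=> a b aA bA gab; have /forall_inP/(_ b bA) := H a aA.
  by rewrite gab eqxx => /eqP.
rewrite negb_forall_in => /exists_inP[a aA].
rewrite negb_forall_in => /exists_inP[b bA].
rewrite negb_imply => /andP[/eqP gab nab].
have im c c' : c \in A -> c' \in A -> c != c' -> g c = g c' ->
    g @: (A :\ c) = g @: A.
  move=> cA' c'A ncc' gcc'; apply/eqP; rewrite finset.eqEsubset; apply/andP; split.
    by apply: imsetS; apply: subD1set.
  apply/fintype.subsetP => _ /imsetP[x xA ->].
  have [->|nxc] := eqVneq x c.
    by rewrite gcc'; apply: imset_f; rewrite !inE eq_sym ncc'.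
  by apply: imset_f; rewrite !inE nxc.
have inj c c' : c \in A -> c' \in A -> c != c' -> g c = g c' ->
    {in A :\ c &, injective g}.
  move=> cA' c'A ncc' gcc'; apply/imset_injP; rewrite (im c c')//.
  by move: cA; rewrite (cardsD1 c) cA' add1n => -[->].
have nba : b != a by rewrite eq_sym.
exists a, b; split => //; split; [exact: (inj a b)|exact: (inj b a)|].
move=> x xA; apply/eqP/idP => [E|]; last first.
  by rewrite !inE => /orP[] /eqP ->; [exact: (im a b)|exact: (im b a)].
have : g x \in g @: (A :\ x) by rewrite E imset_f.
move=> /imsetP[y]; rewrite !inE => /andP[nyx yA] gxy.
have [//|nxa/=] := eqVneq x a.
have [ya|nya] := eqVneq y a.
  apply/eqP; apply: (inj a b) => //; rewrite ?inE ?nxa ?nba//.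
  by rewrite gxy ya.
by case/eqP: nyx; apply: (inj a b) => //; rewrite ?inE ?nxa ?nya.
Qed.

(** The indices in [I] stand both for linear orders on [X], given by the injective
keys [f i], and for colours.  The element [e i] is a slack element: the least
one for the order [i], and above all the non slack elements for the other
orders.  It plays the role of the facet opposite to the vertex [i] of a
simplex, so that no separate treatment of boundary faces is needed. *)
Section Scarf.
Variables (I X : finType) (f : I -> X -> nat) (e : I -> X) (col : X -> I).
Hypothesis f_inj : forall i, injective (f i).
Hypothesis e_min : forall i x, f i (e i) <= f i x.
Hypothesis e_big : forall i j x, j != i -> x \notin codom e ->
  f i x < f i (e j).
Hypothesis col_e : forall i, col (e i) = i.

(** No element is above the minimum of [B] for all the orders at once.  Dominant
sets with [#|I|] elements are the analogue of the cells of a triangulation,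
and those with one element less the analogue of their facets. *)
Definition dominant (B : {set X}) :=
  [forall y, exists i, forall x in B, f i y <= f i x].

Lemma dominantP (B : {set X}) :
  reflect (forall y, exists i, forall x, x \in B -> f i y <= f i x)
          (dominant B).
Proof.
apply: (iffP forallP) => H y.
  by have /existsP[i /forall_inP] := H y; exists i.
by have [i Hi] := H y; apply/existsP; exists i; apply/forall_inP.
Qed.

Lemma dominantS (B C : {set X}) : B \subset C -> dominant C -> dominant B.
Proof.
move=> /fintype.subsetP sBC /dominantP dC; apply/dominantP => y.
by have [i Hi] := dC y; exists i => x /sBC; exact: Hi.
Qed.

(** The elements that complete the facet [d] to a cell. *)
Definition fillers (d : {set X}) : {set X} :=
  [set x | (x \notin d) && dominant (x |: d)].

Let e_inj : injective e.
Proof. exact: can_inj col_e. Qed.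

Let best i (W : {set X}) : {set X} :=
  [set x in W | [forall y in W, f i y <= f i x]].

Let card_best i (W : {set X}) w : w \in W -> #|best i W| = 1.
Proof.
move=> wW; have [x xW xmax] := arg_maxnP (f i) wW.
suff -> : best i W = [set x] by rewrite cards1.
apply/setP => z; rewrite !inE; apply/andP/eqP => [[zW /forall_inP zmax]|->].
  apply: (@f_inj i); apply/eqP; rewrite eqn_leq.
  by rewrite (zmax x xW) andbT; exact: xmax.
by split => //; apply/forall_inP => y; exact: xmax.
Qed.

(** The facet of slack elements opposite to [k] lies on the boundary: an element
completes it exactly when it is the greatest one for the order [k]. *)
Lemma card_fillers_boundary k : #|fillers (e @: ~: [set k])| = 1.
Proof.
set d := e @: _.
have ek : e k \in ~: d.
  by rewrite inE; apply/imsetP => -[j]; rewrite !inE => nj /e_inj kj; rewrite kj eqxx in nj.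
suff -> : fillers d = best k (~: d) by rewrite (card_best k ek).
apply/setP => x; rewrite !inE; apply: andb_id2l => xd.
apply/dominantP/forall_inP => [dx y|xmax y].
  rewrite inE => yd; have [i Hi] := dx y.
  have [<-|nik] := eqVneq i k; first by rewrite Hi// !inE eqxx.
  have ed : e i \in d by apply: imset_f; rewrite !inE.
  have yi : f i y = f i (e i).
    by apply/eqP; rewrite eqn_leq e_min Hi// !inE ed orbT.
  by rewrite (f_inj yi) ed in yd.
have [yd|yd] := boolP (y \in d).
  by case/imsetP: yd => i _ ->; exists i => z _; exact: e_min.
exists k => z; rewrite !inE => /orP[/eqP ->|]; first by rewrite xmax// inE.
case/imsetP => j; rewrite !inE => njk ->.
have [/codomP[i yi]|ny] := boolP (y \in codom e); last exact/ltnW/e_big.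
have [<-|nik] := eqVneq i k; first by rewrite yi e_min.
by rewrite yi imset_f// !inE in yd.
Qed.

(** A facet that contains a non slack element [w] is interior and belongs to two
cells.  It has one element less than there are orders, so exactly two orders
[a] and [b] have the same minimum on it.  Completing it means to give one of
these two orders a new minimum [x]: this [x] has to lie above the minima for
all the other orders, and to be the greatest such element for the order that
was freed. *)
Lemma card_fillers_interior (d : {set X}) w : #|d|.+1 = #|I| -> dominant d ->
  w \in d -> w \notin codom e -> #|fillers d| = 2.
Proof.
move=> cd /dominantP dd wd we.
have /fin_all_exists[mn Hmn] i :
    exists z, z \in d /\ forall x, x \in d -> f i z <= f i x.
  by have [z zd zm] := arg_minnP (f i) wd; exists z.
have mnd i : mn i \in d by case: (Hmn i).
have mnle i x : x \in d -> f i (mn i) <= f i x by case: (Hmn i) => _; exact.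
have mnP i x : x \in d -> (forall y, y \in d -> f i x <= f i y) -> x = mn i.
  by move=> xd xm; apply: (@f_inj i); apply/eqP; rewrite eqn_leq xm// mnle.
have im : mn @: [set: I] = d.
  apply/setP => x; apply/imsetP/idP => [[i _ ->]//|xd].
  by have [i Hi] := dd x; exists i => //; exact: mnP.
have [|a [b [_ _ nab gab [inja injb _]]]] := @imset_collision _ _ mn [set: I].
  by rewrite im cd cardsT.
(* the elements that are free to become the minimum for the order [c] *)
pose M c := [set x | [forall (i | i != c), f i (mn i) < f i x]].
have MP c x : reflect (forall i, i != c -> f i (mn i) < f i x) (x \in M c).
  by rewrite inE; exact: forall_inP.
have MN0 c : e c \in M c.
  apply/MP => i nic.
  have [/codomP[k mk]|] := boolP (mn i \in codom e); last first.
    by apply: e_big; rewrite eq_sym.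
  have [ki|nki] := eqVneq k i; last first.
    have := mnle i w wd; rewrite mk leqNgt (@e_big i k w)//.
  rewrite mk ki ltn_neqAle e_min andbT.
  by apply: contra nic => /eqP/f_inj/e_inj ->.
have disj : best a (M a) :&: best b (M b) = finset.set0.
  apply/setP => x; rewrite !inE.
  apply/negP => /andP[/andP[xa _] /andP[xb _]].
  have xa' : x \in M a by rewrite inE.
  have xb' : x \in M b by rewrite inE.
  have [i Hi] := dd x; have := Hi _ (mnd i); rewrite leqNgt => /negP; apply.
  have [ia|nia] := eqVneq i a; last exact: (MP _ _ xa').
  by apply: (MP _ _ xb'); rewrite ia.
suff -> : fillers d = best a (M a) :|: best b (M b).
  by rewrite cardsU disj cards0 subn0 !(card_best _ (MN0 _)).
have bestP c x : reflect (x \in M c /\ forall y, y \in M c -> f c y <= f c x)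
    (x \in best c (M c)).
  rewrite /best inE; apply: (iffP andP) => -[? H]; split => //.
    exact/forall_inP.
  exact/forall_inP.
apply/setP => x; rewrite inE [RHS]inE; apply/idP/idP.
  move=> /andP[xd /dominantP dx].
  have [a' Ha'] := dx x.
  have nx i : x != mn i by apply: contraNneq xd => ->.
  (* [mn'] gives the minima on [x |: d]; it is onto, hence injective *)
  pose mn' i := if f i x < f i (mn i) then x else mn i.
  have mn'P i : forall z, z \in x |: d -> f i (mn' i) <= f i z.
    move=> z; rewrite /mn' !inE => /orP[/eqP->|zd]; case: ltnP => // h.
    by apply: leq_trans (ltnW h) _; exact: mnle.
    exact: mnle.
  have mn'I : {in [set: I] &, injective mn'}.
    apply/imset_injP.
    suff -> : mn' @: [set: I] = x |: d by rewrite cardsT cardsU1 xd -cd add1n.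
    apply/setP => z; apply/imsetP/idP => [[i _ ->]|zd].
      by rewrite /mn'; case: ifP => _; rewrite !inE ?eqxx ?mnd ?orbT.
    have [i Hi] := dx z; exists i => //; apply: (@f_inj i); apply/eqP.
    rewrite eqn_leq mn'P// andbT Hi//.
    by rewrite /mn'; case: ifP => _; rewrite !inE ?eqxx ?mnd ?orbT.
  have xa' : mn' a' = x.
    rewrite /mn' ltn_neqAle Ha' ?inE ?mnd ?orbT// andbT.
    by case: eqP => // /f_inj xm; case/eqP: (nx a').
  have xM i : i != a' -> f i (mn i) < f i x.
    move=> nia; case: (ltnP (f i (mn i)) (f i x)) => //.
    rewrite leq_eqVlt => /orP[/eqP/f_inj xm|lt]; first by case/eqP: (nx i).
    by case/eqP: nia; apply: mn'I; rewrite ?inE// xa' /mn' lt.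
  have xB : x \in best a' (M a').
    apply/bestP; split; first exact/MP.
    move=> y /MP yM; have [i Hi] := dx y.
    have [<-|nia] := eqVneq i a'; first by rewrite Hi// !inE eqxx.
    by have := yM i nia; rewrite ltnNge Hi// !inE mnd orbT.
  suff : a' \in [set a; b] by case/set2P => <-; rewrite xB ?orbT.
  rewrite !inE; apply/negP => /negP; rewrite negb_or => /andP[na nb].
  have same i : i != a' -> mn' i = mn i by move=> /xM h; rewrite /mn' ltnNge ltnW.
  case/eqP: nab; apply: mn'I; rewrite ?inE//.
  by rewrite !same// eq_sym.
have key c c' : c != c' -> mn c = mn c' -> x \in best c (M c) ->
    (x \notin d) && dominant (x |: d).
  move=> ncc' gcc' /bestP[/MP xM xmax].
  have yc y : y \in M c -> forall z, z \in d -> f c y <= f c z.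
    move=> /MP yM z zd; have [i Hi] := dd y.
    have [<-|nic] := eqVneq i c; first exact: Hi.
    by have := yM i nic; rewrite ltnNge Hi// mnd.
  apply/andP; split.
    rewrite -im; apply/imsetP => -[i _ xi].
    have [ic|nic] := eqVneq i c.
      by have := xM c'; rewrite eq_sym ncc' -gcc' -ic -xi ltnn => /(_ isT).
    by have := xM i nic; rewrite xi ltnn.
  apply/dominantP => y.
  have [yM|] := boolP (y \in M c).
    by exists c => z; rewrite !inE => /orP[/eqP->|]; [exact: xmax|exact: yc].
  rewrite inE negb_forall_in => /exists_inP[i nic].
  rewrite -leqNgt => yi; exists i => z; rewrite !inE => /orP[/eqP->|zd].
    by apply: leq_trans yi (ltnW _); exact: xM.
  by apply: leq_trans yi _; exact: mnle.
case/orP; first exact: (key a b).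
by apply: (key b a); rewrite // eq_sym.
Qed.

(** Fix a colour [i0] and call a facet a door if its colours are all but [i0].
Count the pairs of a cell and a door of that cell.  Seen from the doors, the
number is odd, because the only door on the boundary is the one made of slack
elements.  Seen from the cells, a cell without the colour [i0] that has a door
has two of them, by [imset_collision]; hence some cell has all the colours. *)
Theorem scarf (i0 : I) :
  exists B : {set X}, [/\ dominant B, #|B| = #|I| & col @: B = [set: I]].
Proof.
case: (boolP [exists B : {set X},
    [&& dominant B, #|B| == #|I| & col @: B == [set: I]]]) => [|/existsPn noB].
  by move=> /existsP[B /and3P[dB /eqP cB /eqP colB]]; exists B.
pose NC (d : {set X}) := (col @: d == ~: [set i0]) && (#|d|.+1 == #|I|).
pose N := \sum_(d : {set X} | NC d) #|fillers d|.
have oddN : odd N.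
  pose d0 := e @: ~: [set i0].
  have cold0 : col @: d0 = ~: [set i0].
    by rewrite /d0 -imset_comp (eq_imset _ (g := id) col_e) imset_id.
  have cd0 : #|d0|.+1 = #|I|.
    by rewrite card_imset// -(cardsC [set i0]) cards1 add1n.
  rewrite /N (bigD1 d0) ?/NC ?cold0 ?cd0 ?eqxx//= card_fillers_boundary oddD.
  rewrite (big_morph odd oddD (erefl : odd 0 = false)) big1// => d.
  move=> /andP[/andP[/eqP cold /eqP cd] nd].
  have [w wd we] : exists2 w, w \in d & w \notin codom e.
    apply/exists_inP; apply: contraNT nd; rewrite negb_exists_in => /forall_inP H.
    have slack x : x \in d -> x = e (col x).
      by move=> /H; rewrite negbK => /codomP[i ->]; rewrite col_e.
    apply/eqP; rewrite /d0 -cold -imset_comp.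
    apply/setP => x; apply/idP/imsetP => [xd|[y yd ->]/=].
      by exists x => //=; exact: slack.
    by rewrite -slack.
  have [dd|ndd] := boolP (dominant d); first by rewrite (card_fillers_interior cd dd wd we).
  suff -> : fillers d = finset.set0 by rewrite cards0.
  apply/setP => x; rewrite !inE; apply: contraNF ndd => /andP[_].
  exact/dominantS/finset.subsetUr.
suff : ~~ odd N by rewrite oddN.
have -> : N = \sum_(B : {set X} | dominant B) #|[set x in B | NC (B :\ x)]|.
  transitivity (\sum_(x : X) \sum_(d | NC d && (x \in fillers d)) 1).
    rewrite (exchange_big_dep NC)/=; last by move=> x d _ /andP[].
    by apply: eq_bigr => d NCd; rewrite NCd -sum1_card.
  transitivity (\sum_(x : X) \sum_(B : {set X} | dominant B && ((x \in B) && NC (B :\ x))) 1).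
    apply: eq_bigr => x _.
    rewrite (reindex_onto (fun B => B :\ x) (fun d => x |: d))/=; last first.
      by move=> d /andP[_]; rewrite inE => /andP[xd _]; exact: setU1K.
    apply: eq_bigl => B; rewrite !inE eqxx/=.
    have [xB|xB] := boolP (x \in B).
      by rewrite finset.setD1K// eqxx andbT/= andbC.
    rewrite andbF; apply/negbTE; rewrite negb_and; apply/orP; right.
    by apply: contra xB => /eqP <-; rewrite !inE eqxx.
  rewrite (exchange_big_dep dominant)/=; last by move=> x d _ /andP[].
  apply: eq_bigr => B dB; rewrite -sum1_card.
  by apply: eq_bigl => x; rewrite dB inE.
rewrite (big_morph odd oddD (erefl : odd 0 = false)).
rewrite big1// => B dB.
have [->|[x0]] := set_0Vmem [set x in B | NC (B :\ x)]; first by rewrite cards0.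
rewrite inE => /andP[x0B /andP[/eqP colx0 /eqP cx0]].
have cB : #|B| = #|I| by rewrite (cardsD1 x0) x0B add1n.
have colB : col @: B = ~: [set i0].
  apply/eqP; rewrite finset.eqEsubset -{2}colx0 imsetS ?finset.subsetDl// andbT.
  apply/fintype.subsetP => i icB; rewrite !inE; apply/eqP => ii0.
  have := noB B; rewrite dB cB eqxx/= => /eqP; apply.
  apply/setP => j; rewrite inE; have [->|nj] := eqVneq j i0; first by rewrite -ii0.
  have : j \in ~: [set i0] by rewrite !inE.
  by rewrite -colx0; apply/fintype.subsetP/imsetS/finset.subsetDl.
have [|a [b [aB bB nab _ [_ _ ab]]]] := @imset_collision _ _ col B.
  by rewrite cB colB -cx0 -colx0; rewrite colx0 cx0 -(cardsC [set i0]) cards1 add1n.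
suff -> : [set x in B | NC (B :\ x)] = [set a; b] by rewrite cards2 nab.
apply/setP => x; rewrite inE.
have [xB|xB] /= := boolP (x \in B); last first.
  by apply/esym/negbTE; apply: contra xB => /set2P[] ->.
rewrite -ab// /NC colB; have -> : #|B :\ x|.+1 = #|I| by rewrite -cB (cardsD1 x B) xB.
by rewrite eqxx andbT.
Qed.
End Scarf.

(** The form used below, with no slack elements and with weights [w i] that need
not be injective: ties are broken by the enumeration of [T], which does not
affect the conclusion. *)
Theorem scarf_colours (I T : finType) (w : I -> T -> nat) (c : T -> I) (t0 : T) :
  exists S : {set T}, forall y, exists2 i, i \in c @: S &
    forall x, x \in S -> w i y <= w i x.
Proof.
pose K := #|T|.
pose key i x := w i x * K + enum_rank x.
pose top := \max_(q : I * T) key q.1 q.2.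
have keytop i x : key i x <= top.
  exact: (@leq_bigmax _ (fun q : I * T => key q.1 q.2) (i, x)).
pose f i (z : T + I) := match z with
  | inl x => (key i x).+1
  | inr j => if j == i then 0 else (top + enum_rank j).+2 end.
(* [key] is a base [K] expansion whose leading digit is [w i x] *)
have f_inj i : injective (f i).
  move=> [x|j] [y|k] //=.
  - case; rewrite /key => E; congr inl; apply: enum_rank_inj; apply: val_inj => /=.
    have := congr1 (modn^~ K) E.
    by rewrite /= !modnMDl !modn_small.
  - by case: eqP => // _ [E]; have := keytop i x; lia.
  - by case: eqP => // _ [E]; have := keytop i y; lia.
  - case: eqP => [->|_]; case: eqP => [->|_] // -[E].
    congr inr; apply: enum_rank_inj; apply: val_inj => /=; lia.
have [|||B [dB _ colB]] := @scarf I (T + I)%type f (fun i => inr i)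
    (fun z => match z with inl x => c x | inr j => j end) f_inj _ _ _ (c t0).
- by move=> i x; rewrite /= eqxx.
- move=> i j [x|k]; last by rewrite codom_f.
  by rewrite /= => /negbTE -> _; have := keytop i x; lia.
- by [].
pose S := [set x | inl x \in B].
exists S => y; have [i Hi] := (dominantP _ _ dB) (inl y).
have wle x : x \in S -> w i y <= w i x.
  rewrite inE => /Hi; rewrite /= ltnS /key.
  move=> /(leq_div2r K); rewrite !divnMDl ?(leq_ltn_trans _ (ltn_ord (enum_rank x)))//.
  by rewrite !divn_small ?addn0.
exists i => //; have : i \in [set: I] by [].
rewrite -colB => /imsetP[[x|j] zB /= E]; first by apply/imsetP; exists x; rewrite ?inE.
by have := Hi _ zB; rewrite E /= eqxx.
Qed.

(** The weights are the coordinates and a constant minus their sum, which together behave like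
barycentric coordinates.  A colour [Some i] stands for a coordinate that should
grow, hence it may not occur on the face [x i = N].  In the set [S] given by
[scarf_colours], testing the domination against the point [y] just above the
minima of [S] in the coloured directions, and 0 in the others, shows that [S]
has diameter at most [m] and lies within [m] of the faces [x i = 0] for the
colours [i] that it lacks. *)
Lemma cube_colours (m N : nat) (c : {ffun 'I_m -> 'I_N.+1} -> option 'I_m) :
  (forall x i, c x = Some i -> x i < N) ->
  exists x0, c x0 = None /\ forall i, x0 i <= m \/
    exists x, c x = Some i /\ forall j, x j <= x0 j + m /\ x0 j <= x j + m.
Proof.
move=> cN.
pose w (i : option 'I_m) (x : {ffun 'I_m -> 'I_N.+1}) : nat :=
  if i is Some j then x j else m * N - \sum_j x j.
have [S HS] := scarf_colours w c [ffun=> ord0].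
have sumle (x : {ffun 'I_m -> 'I_N.+1}) : \sum_j x j <= m * N.
  rewrite -[m in m * N]card_ord -sum_nat_const; apply: leq_sum => j _.
  by rewrite -ltnS.
have [x0 x0S cx0] : exists2 x0, x0 \in S & c x0 = None.
  (* the far corner is dominated in no coordinate direction *)
  have [[j|] /imsetP[x xS E] Hj] := HS [ffun=> ord_max]; last by exists x.
  by have := Hj _ xS; rewrite /= ffunE/= leqNgt cN.
pose C := [set j | Some j \in c @: S].
have /fin_all_exists[mu Hmu] j : exists mu : nat,
    (forall x, x \in S -> mu <= x j) /\
    (j \in C -> exists2 x, x \in S & x j = mu :> nat).
  have [x xS xm] := arg_minnP (fun x : {ffun 'I_m -> 'I_N.+1} => x j) x0S.
  by exists (x j : nat); split => // _; exists x.
have mule j x : x \in S -> mu j <= x j by case: (Hmu j) => + _; exact.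
pose y : {ffun 'I_m -> 'I_N.+1} :=
  [ffun j => if j \in C then inord (mu j).+1 else ord0].
have yC j : j \in C -> y j = (mu j).+1 :> nat.
  move=> jC; rewrite ffunE jC inordK// !ltnS.
  move: jC; rewrite inE => /imsetP[x xS E].
  by apply: leq_ltn_trans (mule _ _ xS) _; exact: cN.
have ynC j : j \notin C -> y j = 0 :> nat by move=> jC; rewrite ffunE (negbTE jC).
have sumy : forall x, x \in S -> \sum_j x j <= \sum_j y j.
  have [[j|] jS Hj] := HS y.
    have jC : j \in C by rewrite inE.
    have [x xS xm] := (Hmu j).2 jC.
    by have := Hj _ xS; rewrite /= yC// xm ltnn.
  by move=> x /Hj; rewrite /= leq_sub2lE ?sumle.
have near x j : x \in S -> x j <= (if j \in C then mu j else 0) + m.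
  move=> xS.
  have : \sum_j x j <= \sum_j (if j \in C then mu j else 0) + m.
    apply: leq_trans (sumy _ xS) _.
    rewrite -[X in _ <= _ + X]card_ord -sum1_card -big_split/=.
    apply: leq_sum => k _; have [kC|kC] := boolP (k \in C); first by rewrite yC// addn1.
    by rewrite ynC.
  rewrite (bigD1 j)//= [X in _ <= X + _](bigD1 j)//= => H.
  have sumC : \sum_(i < m | i != j) (if i \in C then mu i else 0) <=
      \sum_(i < m | i != j) x i.
    by apply: leq_sum => k _; case: ifP => // _; exact: mule.
  rewrite -(leq_add2r (\sum_(i < m | i != j) x i)); apply: leq_trans H _.
  by rewrite addnAC leq_add2l.
exists x0; split => // i.
have [iC|iC] := boolP (i \in C); last first.
  by left; have := near _ i x0S; rewrite (negbTE iC) add0n.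
right; move: iC; rewrite inE => /imsetP[x xS E]; exists x; split => // j.
have := near _ j x0S; have := near _ j xS.
have := mule j _ xS; have := mule j _ x0S.
move: (x j : nat) (x0 j : nat) (mu j) => u v t; clear.
by case: ifP => _; lia.
Qed.

Local Open Scope classical_set_scope.
Local Open Scope ring_scope.

(** * Complementarity problems on a cube *)

Definition box (R : realType) m (L : R) : set 'rV[R]_m :=
  [set x | forall i, 0 <= x ord0 i <= L].

(** A grid point gets the colour of some coordinate [i] with [F x i >= 0], if there
is one. *)
Lemma approx_complementarity (R : realType) (m : nat) (L : R)
    (F : 'rV[R]_m -> 'I_m -> R) : 0 < L ->
  (forall x i, box L x -> x ord0 i = L -> F x i < 0) ->
  forall e : R, 0 < e -> exists u, [/\ box L u, forall i, F u i < 0 &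
    forall i, u ord0 i <= e \/
      exists v, [/\ box L v, 0 <= F v i & forall j, `|v ord0 j - u ord0 j| <= e]].
Proof.
move=> L0 FL e e0.
have mesh0 N : 0 <= L / N.+1%:R by rewrite divr_ge0 ?ltW.
have [N Nmesh] : exists N, m%:R * (L / N.+1%:R) <= e.
  exists (Num.bound (m%:R * L / e)).
  rewrite mulrA ler_pdivrMr ?ltr0n// -ler_pdivrMl// [_^-1 * _]mulrC.
  have c0 : 0 <= m%:R * L / e by rewrite divr_ge0 ?mulr_ge0// ltW.
  by apply: le_trans (ltW (archi_boundP c0)) _; rewrite ler_nat.
pose g (x : {ffun 'I_m -> 'I_N.+2}) : 'rV[R]_m :=
  \row_i ((x i : nat)%:R * (L / N.+1%:R)).
have gbox x : box L (g x).
  move=> i; rewrite mxE mulr_ge0//= mulrCA ler_piMr ?(ltW L0)//.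
  by rewrite ler_pdivrMr ?ltr0n// mul1r ler_nat -ltnS.
pose c x := [pick i | 0 <= F (g x) i].
have cS x i : c x = Some i -> 0 <= F (g x) i.
  by rewrite /c; case: pickP => // j Hj [<-].
have [x i /cS cx|x0 [cx0 near]] := @cube_colours m N.+1 c.
  rewrite ltn_neqAle -ltnS ltn_ord andbT; apply/negP => /eqP xN.
  have := FL (g x) i (gbox x); rewrite mxE xN mulrCA mulfV ?pnatr_eq0// mulr1.
  by move=> /(_ erefl); rewrite ltNge cx.
exists (g x0); split => //.
  move=> i; move: cx0; rewrite /c; case: pickP => // H _.
  by rewrite ltNge H.
have small k : (k <= m)%N -> k%:R * (L / N.+1%:R) <= e.
  by move=> km; apply: le_trans Nmesh; rewrite ler_wpM2r// ler_nat.
move=> i; have [x0i|[x [/cS cx nx]]] := near i; first by left; rewrite mxE small.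
right; exists (g x); split => // j; rewrite !mxE -mulrBl normrM (ger0_norm (mesh0 N)).
have [n1 n2] := nx j.
apply: le_trans (ler_wpM2r (mesh0 N) _) Nmesh.
move: n1 n2; rewrite -!(ler_nat R) !natrD ler_norml => n1 n2.
by apply/andP; split; lra.
Qed.

(** At a cluster point of the approximate solutions, continuity turns the strict
inequalities into weak ones, and excludes [F x i < 0] at a positive coordinate
because [F _ i] takes nonnegative values arbitrarily close to [x]. *)
Theorem complementarity (R : realType) (m : nat) (L : R)
    (F : 'rV[R]_m -> 'I_m -> R) : 0 < L ->
  (forall x i, box L x -> {for x, continuous (F^~ i)}) ->
  (forall x i, box L x -> x ord0 i = L -> F x i < 0) ->
  exists2 x, box L x & forall i, F x i <= 0 /\ (0 < x ord0 i -> F x i = 0).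
Proof.
move=> L0 Fc FL.
have /choice[u Hu] (n : nat) : exists u, _ :=
  approx_complementarity L0 FL (e := n.+1%:R^-1) ltac:(by rewrite invr_gt0 ltr0n).
have boxc : compact (@box R m L).
  have := @rV_compact R m (fun=> `[0, L]%classic) (fun=> @segment_compact R 0 L).
  by congr (compact _); apply/seteqP; split => x /= H i; have := H i; rewrite in_itv.
have [|x [bx clx]] := boxc (u @ \oo) _.
  by exists 0%N => // n _; have [] := Hu n.
have Fle i : F x i <= 0.
  rewrite leNgt; apply/negP => Fx.
  have nF : nbhs x [set y | 0 < F y i] by exact: (Fc x i bx [set z | 0 < z] (lt_nbhsr Fx)).
  have [y [[n _ <-]] /=] : range u `&` [set y | 0 < F y i] !=set0.
    by apply: clx => //; exists 0%N => // n _; exists n.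
  by have [_ /(_ i) + _] := Hu n => /lt_trans h /h; rewrite ltxx.
exists x => // i; split => // xi; apply/eqP; apply: contraT => nFx.
have Fx : F x i < 0 by rewrite lt_neqAle nFx Fle.
have nF : nbhs x [set y | F y i < 0] by exact: (Fc x i bx [set z | z < 0] (lt_nbhsl Fx)).
have /nbhs_ballP[d d0 Hd] := nF.
pose r := Num.min (d / 2) (x ord0 i / 2).
have r0 : 0 < r by rewrite lt_min !divr_gt0.
have rd : r <= d / 2 by rewrite ge_min lexx.
have rx : r <= x ord0 i / 2 by rewrite ge_min lexx orbT.
have nu : (u @ \oo) (u @` [set n | n.+1%:R^-1 < r]).
  apply: filterS (near_infty_natSinv_lt (PosNum r0)) => n nr; exact: imageP.
have [_ [[n/= nr <-] [_ ux]]] := clx _ _ nu (nbhsx_ballx _ _ r0).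
have [_ _ /(_ i)[uin|[v [_ Fv nv]]]] := Hu n.
  have := ux ord0 i; rewrite /ball/= ltr_norml => /andP[_ h].
  suff : x ord0 i < x ord0 i by rewrite ltxx.
  rewrite [ltRHS]splitr -ltrBlDr (lt_le_trans _ rx)// (le_lt_trans _ h)//.
  by rewrite lerB// (le_trans uin)// (le_trans (ltW nr)).
suff : F v i < 0 by rewrite ltNge Fv.
apply: Hd; split => // i0 j; rewrite ord1.
have vu : `|v ord0 j - u n ord0 j| <= r := le_trans (nv j) (ltW nr).
have xu : `|x ord0 j - u n ord0 j| < r := ux ord0 j.
rewrite /ball/= -[_ - _](subrKA (u n ord0 j)) (le_lt_trans (ler_normD _ _))//.
by rewrite [ltRHS]splitr ltr_leD ?(lt_le_trans xu)// distrC (le_trans vu).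
Qed.

(** * The generator of the chain *)

Lemma val_prv M (j : 'I_M) : prv j = j.-1 :> nat.
Proof. by rewrite /prv val_insubd (leq_ltn_trans (leq_pred _)). Qed.

Lemma val_nxt M (j : 'I_M) : (j.+1 < M)%N -> nxt j = j.+1 :> nat.
Proof. by move=> jM; rewrite /nxt val_insubd jM. Qed.

Section Generator.
Variables (R : realType) (M : nat) (s : 'I_M -> R).
Hypothesis s_incr : forall j k : 'I_M, (j < k)%N -> s j < s k.

Lemma prv_lt j : inner j -> s (prv j) < s j.
Proof.
move=> ij; apply: s_incr; rewrite val_prv// prednK//.
by case/andP: ij.
Qed.

Lemma nxt_lt j : inner j -> s j < s (nxt j).
Proof. by case/andP=> _ jM; apply: s_incr; rewrite val_nxt. Qed.

(** The divided second difference of [f] at [j], normalized so that [1 + generator]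
is the transition operator of the chain with all the inner [q j] equal to 1. *)
Definition generator (f : 'I_M -> R) (j : 'I_M) : R :=
  if inner j then
    (f (nxt j) - f j) * ((s j - s (prv j)) / (s (nxt j) - s (prv j))) +
    (f (prv j) - f j) * ((s (nxt j) - s j) / (s (nxt j) - s (prv j)))
  else 0.

Definition vanishes_at_ends (q : 'I_M -> R) := forall j, ~~ inner j -> q j = 0.

Lemma dmrw_matrix_action (q f : 'I_M -> R) j : vanishes_at_ends q ->
  \sum_k dmrw_matrix s q j k * f k = f j + q j * generator f j.
Proof.
move=> q0; rewrite (bigD1 j)//= !mxE eqxx /generator.
have [ij|nij] := boolP (inner j); last first.
  rewrite big1 ?q0// ?subr0 ?mul1r ?mul0r//= => k kj.
  by rewrite !mxE (negbTE kj) (negbTE nij)/= mul0r.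
have pj : prv j != j.
  by apply/eqP => E; have := prv_lt ij; rewrite E ltxx.
have nj : nxt j != j.
  by apply/eqP => E; have := nxt_lt ij; rewrite E ltxx.
have np : nxt j != prv j.
  apply/eqP => E; have := lt_trans (prv_lt ij) (nxt_lt ij).
  by rewrite E ltxx.
rewrite (bigD1 (prv j))//= (bigD1 (nxt j))/=; last by rewrite nj np.
rewrite big1 => [|k /andP[/andP[kj kp] kn]]; last first.
  by rewrite !mxE (negbTE kj) (negbTE kp) (negbTE kn) ij mul0r.
rewrite !mxE (negbTE pj) (negbTE nj) (negbTE np) ij !eqxx/=.
have d0 : s (nxt j) - s (prv j) != 0.
  by rewrite gt_eqF// subr_gt0 (lt_trans (prv_lt ij) (nxt_lt ij)).
by field.
Qed.

Lemma generator_affine (a b : R) j : generator (fun k => a * s k + b) j = 0.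
Proof.
rewrite /generator; case: ifP => // ij.
have d0 : s (nxt j) - s (prv j) != 0.
  by rewrite gt_eqF// subr_gt0 (lt_trans (prv_lt ij) (nxt_lt ij)).
by field.
Qed.

(** The variance of one jump from the inner state [j], as [generator_sqr] and
[generator_affine] show. *)
Definition local_variance j := (s (nxt j) - s j) * (s j - s (prv j)).

Lemma local_variance_gt0 j : inner j -> 0 < local_variance j.
Proof. by move=> ij; rewrite mulr_gt0// subr_gt0 ?prv_lt ?nxt_lt. Qed.

Lemma generator_sqr j : inner j -> generator (fun k => s k ^+ 2) j = local_variance j.
Proof.
move=> ij; rewrite /generator ij /local_variance.
have d0 : s (nxt j) - s (prv j) != 0.
  by rewrite gt_eqF// subr_gt0 (lt_trans (prv_lt ij) (nxt_lt ij)).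
by field.
Qed.

(** The convex test function [(s - s j)^+]: its only kink is at [j], so that its
mean under the law of the chain changes only through the visits to [j]. *)
Definition call_payoff (j k : 'I_M) : R := Num.max (s k - s j) 0.

Lemma s_nondecreasing (j k : 'I_M) : (j <= k)%N -> s j <= s k.
Proof.
rewrite leq_eqVlt => /orP[/eqP/val_inj -> //|/s_incr/ltW//].
Qed.

Lemma generator_call i j : i != j -> generator (call_payoff j) i = 0.
Proof.
move=> nij; rewrite /generator; case: ifP => // ii; case/andP: (ii) => i0 iM.
have [ij|ji|/val_inj E] := ltngtP i j; last by rewrite E eqxx in nij.
  have c0 (k : 'I_M) : (k <= j)%N -> call_payoff j k = 0.
    by move=> kj; apply/max_idPr; rewrite subr_le0 s_nondecreasing.
  have pj : (prv i <= j)%N by rewrite val_prv// (leq_trans (leq_pred _))// ltnW.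
  have nj : (nxt i <= j)%N by rewrite val_nxt.
  by rewrite (c0 _ pj) (c0 _ nj) (c0 _ (ltnW ij)) subrr !mul0r addr0.
have cE (k : 'I_M) : (j <= k)%N -> call_payoff j k = 1 * s k + (- s j).
  by move=> jk; rewrite mul1r; apply/max_idPl; rewrite subr_ge0 s_nondecreasing.
have := generator_affine 1 (- s j) i; rewrite /generator ii.
have jp : (j <= prv i)%N by rewrite val_prv// -ltnS prednK// (leq_ltn_trans _ ji).
have jn : (j <= nxt i)%N by rewrite val_nxt// ltnW// ltnW.
by rewrite (cE _ jp) (cE _ jn) (cE _ (ltnW ji)).
Qed.

(** At a minimum of [f] the generator is nonnegative. *)
Lemma minimum_principle (l f : 'I_M -> R) :
  (forall j, 0 <= l j) -> (forall j, 0 <= f j - l j * generator f j) ->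
  forall j, 0 <= f j.
Proof.
move=> l0 Hf j0.
have [j _ jmin] := @Order.TotalTheory.arg_minP _ R _ j0 predT f erefl.
apply: le_trans (jmin j0 erefl); have := Hf j.
suff : 0 <= l j * generator f j.
  by move=> h; rewrite subr_ge0; exact: le_trans.
rewrite mulr_ge0// /generator; case: ifP => // ij.
have p0 := prv_lt ij; have n0 := nxt_lt ij.
have d0 : 0 <= s (nxt j) - s (prv j) by rewrite subr_ge0 ltW// (lt_trans p0 n0).
by rewrite addr_ge0// mulr_ge0// ?subr_ge0 ?jmin// divr_ge0// subr_ge0 ltW.
Qed.

(** The matrix [1 - G(l)]; here [l] is any family of rates, not bounded by 1. *)
Definition resolvent_inv (l : 'I_M -> R) : 'M[R]_M :=
  1%:M - (dmrw_matrix s l - 1%:M).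

Lemma resolvent_inv_action l (f : 'I_M -> R) j : vanishes_at_ends l ->
  \sum_k resolvent_inv l j k * f k = f j - l j * generator f j.
Proof.
move=> l0.
have E k : resolvent_inv l j k =
    (1%:M : 'M[R]_M) j k - (dmrw_matrix s l j k - (1%:M : 'M[R]_M) j k).
  by rewrite [LHS]mxE [X in _ + X]mxE [X in _ - X]mxE [X in _ - (_ + X)]mxE.
under eq_bigr do rewrite E !mulrBl.
have id : \sum_k (1%:M : 'M[R]_M) j k * f k = f j.
  rewrite (bigD1 j)//= big1 ?addr0 ?mxE ?eqxx ?mul1r// => k kj.
  by rewrite mxE eq_sym (negbTE kj) mul0r.
rewrite !sumrB id dmrw_matrix_action//; ring.
Qed.

Section Rate.
Variable l : 'I_M -> R.
Hypothesis l_ge0 : forall j, 0 <= l j.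
Hypothesis l_ends : vanishes_at_ends l.

Lemma resolvent_inv_ge0 (f : 'cV[R]_M) : (forall j, 0 <= (resolvent_inv l *m f) j 0) ->
  forall j, 0 <= f j 0.
Proof.
move=> H; apply: (@minimum_principle l) => // j.
by rewrite -resolvent_inv_action//; have := H j; rewrite mxE.
Qed.

Lemma resolvent_inv_unit : resolvent_inv l \in unitmx.
Proof.
rewrite -unitmx_tr -row_free_unit -kermx_eq0; apply/eqP.
set K := kermx _; have := mulmx_ker (resolvent_inv l)^T.
rewrite -/K => /(congr1 trmx); rewrite trmx_mul trmxK trmx0 => KK.
apply/matrixP => i j; rewrite mxE.
have E : resolvent_inv l *m col i K^T = 0.
  by rewrite colE mulmxA KK mul0mx.
have := resolvent_inv_ge0 (f := col i K^T) _ j.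
have := resolvent_inv_ge0 (f := - col i K^T) _ j.
rewrite mulmxN E oppr0 !mxE => a b; apply/eqP; rewrite eq_le.
by rewrite b ?andbT -1?oppr_ge0 ?a// => k; rewrite mxE.
Qed.

Lemma invmx_resolvent_ge0 i j : 0 <= invmx (resolvent_inv l) i j.
Proof.
have := resolvent_inv_ge0 (f := col j (invmx (resolvent_inv l))) _ i.
rewrite mxE; apply => k; rewrite colE mulmxA mulmxV ?resolvent_inv_unit// mul1mx !mxE.
by case: eqP.
Qed.

End Rate.
End Generator.

(** * Continuity of the matrix inverse *)

Section MatrixContinuity.
Variables (R : realType) (T : topologicalType) (x : T).

Lemma cvg_if_cst (b : bool) (f : T -> R) (c : R) :
  (b -> f y @[y --> x] --> f x) ->
  (if b then f y else c) @[y --> x] --> (if b then f x else c).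
Proof. by case: b => [/(_ isT)//|_]; exact: cvg_cst. Qed.

Lemma cvg_sub_cst (f : T -> R) (c : R) :
  f y @[y --> x] --> f x -> f y - c @[y --> x] --> f x - c.
Proof. by move=> ?; apply: cvgB => //; exact: cvg_cst. Qed.

Definition mx_cvg m n (A : T -> 'M[R]_(m, n)) :=
  forall i j, A y i j @[y --> x] --> A x i j.

Lemma mx_cvg_mul m n p (A : T -> 'M[R]_(m, n)) (B : T -> 'M[R]_(n, p)) :
  mx_cvg A -> mx_cvg B -> mx_cvg (fun y => A y *m B y).
Proof.
move=> cA cB i j; rewrite mxE; under eq_cvg do rewrite mxE.
apply: (@cvg_big _ _ +%R 0 xpredT); first exact: add_continuous.
by move=> k _; apply: cvgM; [exact: cA|exact: cB].
Qed.

Lemma cvg_det n (A : T -> 'M[R]_n) : mx_cvg A ->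
  \det (A y) @[y --> x] --> \det (A x).
Proof.
move=> cA; rewrite /determinant.
apply: (@cvg_big _ _ +%R 0 xpredT); first exact: add_continuous.
move=> g _; apply: cvgM; first exact: cvg_cst.
apply: (@cvg_big R _ (@GRing.mul R) 1 xpredT (@mul_continuous R)) => k _; exact: cA.
Qed.

Lemma mx_cvg_adj n (A : T -> 'M[R]_n) : mx_cvg A -> mx_cvg (fun y => \adj (A y)).
Proof.
move=> cA i j; rewrite mxE; under eq_cvg do rewrite mxE.
rewrite /cofactor; apply: cvgM; first exact: cvg_cst.
apply: cvg_det => a b; rewrite !mxE; under eq_cvg do rewrite !mxE.
exact: cA.
Qed.

(** Near a unit, [invmx] agrees with the Cramer formula, which is continuous. *)
Lemma mx_cvg_invmx n (A : T -> 'M[R]_n) : A x \in unitmx -> mx_cvg A ->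
  mx_cvg (fun y => invmx (A y)).
Proof.
move=> Ax cA i j.
have dA : \det (A x) != 0 by move: Ax; rewrite unitmxE unitfE.
have nE : \forall y \near x,
    ((\det (A y))^-1 *: \adj (A y)) i j = invmx (A y) i j.
  near=> y; rewrite /invmx ifT// unitmxE unitfE; near: y.
  exact: cvgr_neq0 (cvg_det cA) dA.
rewrite (_ : invmx (A x) i j = ((\det (A x))^-1 *: \adj (A x)) i j); last first.
  by rewrite /invmx Ax.
apply: cvg_trans; first exact: (near_eq_cvg nE).
rewrite mxE; under eq_cvg do rewrite mxE.
by apply: cvgM; [apply: cvgV => //; exact: cvg_det|exact: mx_cvg_adj].
Unshelve. all: end_near. Qed.

End MatrixContinuity.

(** * Rates that give the target law *)

Section Solve.
Variables (R : realType) (M : nat) (s : 'I_M -> R).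
Hypothesis s_incr : forall j k : 'I_M, (j < k)%N -> s j < s k.

(** The law of the chain run in continuous time with rates [l] after [k]
independent exponential times of mean 1, started from [mu]. *)
Definition law_after (mu : 'rV[R]_M) (l : 'I_M -> R) (k : nat) : 'rV[R]_M :=
  iter k (fun v => v *m invmx (resolvent_inv s l)) mu.

Definition mean (v : 'rV[R]_M) (f : 'I_M -> R) : R := \sum_j v 0 j * f j.

Section Rate.
Variables (mu : 'rV[R]_M) (l : 'I_M -> R).
Hypothesis mu_ge0 : forall j, 0 <= mu 0 j.
Hypothesis l_ge0 : forall j, 0 <= l j.
Hypothesis l_ends : vanishes_at_ends l.

Lemma law_after_ge0 k j : 0 <= law_after mu l k 0 j.
Proof.
elim: k j => [|k IHk] j //=; rewrite mxE sumr_ge0// => i _.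
by rewrite mulr_ge0// invmx_resolvent_ge0.
Qed.

(** The resolvent form of the Dynkin formula: the mean of [f] grows by the mean of
its generator. *)
Lemma mean_law_afterS k f : mean (law_after mu l k.+1) f =
  mean (law_after mu l k) f +
  \sum_j law_after mu l k.+1 0 j * (l j * generator s f j).
Proof.
set v := law_after mu l k.+1.
have -> : law_after mu l k = v *m resolvent_inv s l.
  by rewrite /v /= mulmxKV// resolvent_inv_unit.
rewrite /mean.
have -> : \sum_j (v *m resolvent_inv s l) 0 j * f j =
    \sum_j v 0 j * (f j - l j * generator s f j).
  under eq_bigr do rewrite mxE mulr_suml.
  rewrite exchange_big/=; apply: eq_bigr => i _.
  rewrite -resolvent_inv_action// mulr_sumr.
  by apply: eq_bigr => j _; rewrite mulrA.
by rewrite -big_split/=; apply: eq_bigr => j _; ring.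
Qed.

Lemma mean_law_after k f : (forall j, l j * generator s f j = 0) ->
  mean (law_after mu l k) f = mean mu f.
Proof.
move=> H; elim: k => // k IHk; rewrite mean_law_afterS IHk big1 ?addr0// => j _.
by rewrite H mulr0.
Qed.

Lemma mean_law_after_affine k a b :
  mean (law_after mu l k) (fun j => a * s j + b) = mean mu (fun j => a * s j + b).
Proof. by apply: mean_law_after => j; rewrite generator_affine ?mulr0. Qed.

End Rate.

Lemma law_after_continuous (mu : 'rV[R]_M) (k : nat) (T : topologicalType)
    (x : T) (l : T -> 'I_M -> R) :
  (forall j, 0 <= l x j) -> (forall y, vanishes_at_ends (l y)) ->
  (forall j, l y j @[y --> x] --> l x j) ->
  mx_cvg x (fun y => law_after mu (l y) k).
Proof.
move=> l0 le cl; elim: k => [|k IHk] /=; first by move=> i j; exact: cvg_cst.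
apply: mx_cvg_mul => //; apply: mx_cvg_invmx; first exact: resolvent_inv_unit.
move=> i j; rewrite !mxE; under eq_cvg do rewrite !mxE.
apply: cvgB; first exact: cvg_cst.
apply: cvgB; last exact: cvg_cst.
case: (j == i); first by apply: cvgB => //; exact: cvg_cst.
case: (_ && _); first by apply: cvgM => //; exact: cvg_cst.
case: (_ && _); first by apply: cvgM => //; exact: cvg_cst.
exact: cvg_cst.
Qed.

Lemma not_inner_ends (j0 j1 j : 'I_M) : j0 = 0%N :> nat -> j1.+1 = M :> nat ->
  ~~ inner j -> j = j0 \/ j = j1.
Proof.
move=> E0 E1; rewrite /inner negb_and -leqNgt leqn0 -leqNgt.
case/orP => [/eqP|] H; [left|right]; apply: val_inj => /=; first by rewrite H E0.
by apply/eqP; rewrite -eqSS E1 eqn_leq H ltn_ord.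
Qed.

Section Target.
Variables (mu : 'rV[R]_M) (p : 'I_M -> R) (e : R) (r : nat) (j0 j1 : 'I_M).
Hypothesis j0E : j0 = 0%N :> nat.
Hypothesis j1E : j1.+1 = M :> nat.
Hypothesis j01 : (j0 < j1)%N.
Hypothesis mu_ge0 : forall j, 0 <= mu 0 j.
Hypothesis mu_sum1 : \sum_j mu 0 j = 1.
Hypothesis mu_mean : \sum_j mu 0 j * s j = e.
Hypothesis mu_call : forall j, inner j -> mean mu (call_payoff s j) = Num.max (e - s j) 0.
Hypothesis p_gt0 : forall j, 0 < p j.
Hypothesis p_sum1 : \sum_j p j = 1.
Hypothesis p_mean : \sum_j p j * s j = e.

(** Jensen's inequality is strict, as [p] charges both ends and the kink of
[call_payoff] is at an inner state. *)
Lemma jensen_call j : inner j -> Num.max (e - s j) 0 < \sum_k p k * call_payoff s j k.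
Proof.
move=> ij; case/andP: (ij) => j_gt0 jM.
have s0j : s j0 < s j by apply: s_incr; rewrite j0E.
have sj1 : s j < s j1 by apply: s_incr; rewrite -ltnS j1E.
rewrite /Order.max; case: (ltP (e - s j) 0) => es.
  rewrite (bigD1 j1)//= ltr_pwDl//.
    by rewrite mulr_gt0// /call_payoff lt_max subr_gt0 sj1.
  by rewrite sumr_ge0// => k _; rewrite mulr_ge0 ?(ltW (p_gt0 _))// /call_payoff le_max lexx orbT.
have -> : e - s j = \sum_k p k * (s k - s j).
  under eq_bigr do rewrite mulrBr.
  by rewrite sumrB p_mean -mulr_suml p_sum1 mul1r.
rewrite -subr_gt0 -sumrB (bigD1 j0)//= ltr_pwDl//.
  rewrite -mulrBr mulr_gt0// subr_gt0 /call_payoff lt_max.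
  by rewrite subr_lt0 s0j orbT.
rewrite sumr_ge0// => k _; rewrite -mulrBr mulr_ge0 ?(ltW (p_gt0 _))//.
by rewrite subr_ge0 /call_payoff le_max lexx.
Qed.

Section Rate.
Variables (l : 'I_M -> R).
Hypothesis l_ge0 : forall j, 0 <= l j.
Hypothesis l_ends : vanishes_at_ends l.
Let nu := law_after mu l r.

Lemma law_after_sum1 k : \sum_j law_after mu l k 0 j = 1.
Proof.
rewrite -mu_sum1; have := mean_law_after_affine mu l_ge0 l_ends k 0 1.
by rewrite /mean; under eq_bigr do rewrite mul0r add0r mulr1;
   under [RHS]eq_bigr do rewrite mul0r add0r mulr1.
Qed.

Lemma law_after_mean k : \sum_j law_after mu l k 0 j * s j = e.
Proof.
rewrite -mu_mean; have := mean_law_after_affine mu l_ge0 l_ends k 1 0.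
by rewrite /mean; under eq_bigr do rewrite mul1r addr0;
   under [RHS]eq_bigr do rewrite mul1r addr0.
Qed.

(** The mean of [s^2] is bounded, and each step raises it by the local variance
gathered at all the states, hence at [j] in particular.  So a large rate [l j]
leaves little mass at [j]. *)
Lemma law_after_bound k j : inner j ->
  law_after mu l k.+1 0 j * (l j * local_variance s j) <= \sum_i s i ^+ 2.
Proof.
move=> ij.
have ge0 n i : 0 <= law_after mu l n 0 i by exact: law_after_ge0.
have le1 n i : law_after mu l n 0 i <= 1.
  by rewrite -(law_after_sum1 n) (bigD1 i)//= lerDl sumr_ge0.
apply: le_trans (_ : mean (law_after mu l k.+1) (fun i => s i ^+ 2) <= _); last first.
  by apply: ler_sum => i _; rewrite ler_piMl// sqr_ge0.
rewrite mean_law_afterS// -[leLHS]add0r lerD//.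
  by rewrite sumr_ge0// => i _; rewrite mulr_ge0// sqr_ge0.
rewrite (bigD1 j)//= generator_sqr// lerDl sumr_ge0// => i _.
have [ii|nii] := boolP (inner i); last by rewrite l_ends// mul0r mulr0.
by rewrite generator_sqr// mulr_ge0 ?(ge0 k.+1 i)// mulr_ge0// ltW// local_variance_gt0.
Qed.

(** If [l j = 0] then the mean of [call_payoff j] is still the initial one, strictly
less than under [p].  This contradicts that [p - nu], of mass 0 and mean 0 and
nonnegative inside, integrates a convex function to at most 0.  Once all the
inner rates are positive, mass and mean settle the two ends. *)
Lemma complementary_rate :
  (forall j, inner j -> nu 0 j <= p j) ->
  (forall j, inner j -> 0 < l j -> nu 0 j = p j) ->
  (forall j, inner j -> 0 < l j) /\ forall j, nu 0 j = p j.
Proof.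
move=> nup nuE.
have sum0 : \sum_k (p k - nu 0 k) = 0 by rewrite sumrB p_sum1 law_after_sum1 subrr.
have mean0 : \sum_k (p k - nu 0 k) * s k = 0.
  by under eq_bigr do rewrite mulrBl; rewrite sumrB p_mean law_after_mean subrr.
have aff0 a b : \sum_k (p k - nu 0 k) * (a * (s k - b)) = 0.
  transitivity (a * \sum_k (p k - nu 0 k) * s k - a * b * \sum_k (p k - nu 0 k)).
    by rewrite !mulr_sumr -sumrB; apply: eq_bigr => k _; ring.
  by rewrite sum0 mean0 !mulr0 subrr.
have s01 : s j0 < s j1 by exact: s_incr.
have lpos j : inner j -> 0 < l j.
  move=> ij; rewrite lt_neqAle l_ge0 andbT eq_sym; apply/negP => /eqP lj0.
  case/andP: (ij) => j_gt0 jM.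
  have s0j : s j0 < s j by apply: s_incr; rewrite j0E.
  have sj1 : s j < s j1 by apply: s_incr; rewrite -ltnS j1E.
  have nuc : mean nu (call_payoff s j) = Num.max (e - s j) 0.
    rewrite -mu_call// mean_law_after// => i.
    have [->|nij] := eqVneq i j; first by rewrite lj0 mul0r.
    by rewrite generator_call// mulr0.
  have : \sum_k p k * call_payoff s j k <= mean nu (call_payoff s j); last first.
    by rewrite nuc leNgt jensen_call.
  rewrite -subr_le0 -sumrB.
  (* compare the payoff with its chord between the end states, which [p - nu]
     integrates to 0; both sides are multiplied by [s j1 - s j0] *)
  suff : (s j1 - s j0) * (\sum_k (p k * call_payoff s j k - nu 0 k * call_payoff s j k)) <=
      \sum_k (p k - nu 0 k) * ((s j1 - s j) * (s k - s j0)).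
    by rewrite aff0 pmulr_rle0 ?subr_gt0.
  rewrite mulr_sumr; apply: ler_sum => k _.
  rewrite -mulrBl mulrCA.
  have [ik|nik] := boolP (inner k); last first.
    suff -> : (s j1 - s j0) * call_payoff s j k = (s j1 - s j) * (s k - s j0) by [].
    rewrite /call_payoff; have [->|->] := not_inner_ends j0E j1E nik.
      by rewrite max_r ?subr_le0 ?ltW// subrr !mulr0.
    by rewrite max_l ?subr_ge0 ?ltW// mulrC.
  have k0 : s j0 < s k by apply: s_incr; rewrite j0E; case/andP: ik.
  have k1 : s k < s j1 by apply: s_incr; rewrite -ltnS j1E; case/andP: ik.
  rewrite ler_wpM2l ?subr_ge0 ?nup// /call_payoff /Order.max; case: ifP => _; last by nra.
  by rewrite mulr0 mulr_ge0// subr_ge0 ltW.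
split => // j.
have inn k : inner k -> nu 0 k = p k by move=> ik; exact: nuE (lpos k ik).
have [ij|nij] := boolP (inner j); first exact: inn.
(* [s - b] vanishes at the end other than [j], so only [j] is left in [aff0] *)
have end0 b : (forall k, k = j0 \/ k = j1 -> k != j -> s k = b) -> s j != b -> nu 0 j = p j.
  move=> Hb bj; have := aff0 1 b; rewrite (bigD1 j)//= big1 ?addr0 => [|k kj].
    move/eqP; rewrite mulf_eq0 mul1r [_ - b == 0]subr_eq0 (negbTE bj) orbF.
    by rewrite subr_eq0 => /eqP ->.
  have [ik|nik] := boolP (inner k); first by rewrite inn// subrr mul0r.
  by rewrite (Hb k _ kj) ?subrr ?mulr0//; exact: not_inner_ends.
have [jE|jE] := not_inner_ends j0E j1E nij.
  apply: (end0 (s j1)); last by rewrite jE lt_eqF.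
  by move=> k [->|-> //]; rewrite jE eqxx.
apply: (end0 (s j0)); last by rewrite jE gt_eqF.
by move=> k [-> //|->]; rewrite jE eqxx.
Qed.

End Rate.

(** The cube has a coordinate for each state.  The rates of the end states are kept
at 0, and the constant value [-1] of [F] there leaves nothing to solve. *)
Theorem exists_rates : (0 < r)%N -> exists l : 'I_M -> R,
  [/\ forall j, inner j -> 0 < l j, vanishes_at_ends l &
      forall j, law_after mu l r 0 j = p j].
Proof.
move=> r0.
pose L := 1 + \sum_j `|(\sum_i s i ^+ 2) / (local_variance s j * p j)|.
have L0 : 0 < L by rewrite ltr_pwDl// sumr_ge0.
pose rate (x : 'rV[R]_M) j := if inner j then x 0 j else 0.
pose F x j := if inner j then law_after mu (rate x) r 0 j - p j else -1.
have rate_ends x : vanishes_at_ends (rate x).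
  by move=> j /negbTE nj; rewrite /rate nj.
have rate_ge0 x : box L x -> forall j, 0 <= rate x j.
  by move=> bx j; rewrite /rate; case: ifP => // _; have /andP[] := bx j.
have [||x bx Hx] := @complementarity R M L F L0.
- move=> x j bx; apply: (@cvg_if_cst _ _ x) => ij.
  apply: (@cvg_sub_cst _ _ x).
  apply: (@law_after_continuous mu r _ x rate) => //; first exact: rate_ge0.
  by move=> i; apply: (@cvg_if_cst _ _ x) => _; exact: coord_continuous.
- move=> x j bx xj; rewrite /F; case: ifPn => ij; last by rewrite ltrN10.
  rewrite subr_lt0 -(prednK r0).
  have g0 := local_variance_gt0 s_incr ij.
  have := law_after_bound (rate_ge0 _ bx) (rate_ends x) r.-1 ij.
  rewrite [rate x j]/rate ij xj; set v := law_after _ _ _ 0 j => vL.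
  have Lj : (\sum_i s i ^+ 2) < L * (local_variance s j * p j).
    rewrite -ltr_pdivrMr; last exact: mulr_gt0 g0 (p_gt0 j).
    apply: le_lt_trans (ler_norm _) _.
    rewrite /L [X in _ < 1 + X](bigD1 j)//= addrCA ltrDl ltr_pwDl//.
    by rewrite sumr_ge0.
  rewrite -(ltr_pM2r (mulr_gt0 L0 g0)); apply: le_lt_trans vL _.
  by rewrite mulrC -mulrA.
exists (rate x).
have [||lp lE] := @complementary_rate (rate x) (rate_ge0 _ bx) (rate_ends x).
- by move=> j ij; have [+ _] := Hx j; rewrite /F ij subr_le0.
- move=> j ij; have -> : rate x j = x 0 j by rewrite /rate ij.
  have [_] := Hx j; rewrite /F ij => H /H /eqP.
  by rewrite subr_eq0 => /eqP.
by split.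
Qed.

End Target.
End Solve.

(** * Negative binomial mixtures *)

(** The convention for [r = 0], the time that is constantly 0, starts the
inductions on [r]. *)
Definition nbin_coef (r k : nat) : nat :=
  if r is r'.+1 then 'C(r' + k, r') else k == 0%N.

Definition nbin (R : realType) (a : R) (r k : nat) : R :=
  (nbin_coef r k)%:R * (1 - a) ^+ r * a ^+ k.

Section NegativeBinomial.
Variables (R : realType) (a : R).

Lemma nbin0 r : nbin a r 0 = (1 - a) ^+ r.
Proof. by case: r => [|r]; rewrite /nbin /= ?addn0 ?binn expr0 mulr1 mul1r. Qed.

Lemma nbin_pascal r k :
  nbin a r.+1 k.+1 = a * nbin a r.+1 k + (1 - a) * nbin a r k.+1.
Proof.
have E : nbin_coef r.+1 k.+1 = (nbin_coef r.+1 k + nbin_coef r k.+1)%N.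
  case: r => [|r] /=; first by rewrite !bin0.
  by rewrite addnS binS addSnnS.
rewrite /nbin E natrD !exprS; ring.
Qed.

End NegativeBinomial.

(** The recursion [nbin_pascal] writes each weight as a convex combination of
earlier ones. *)
Lemma nbin_le1 (R : realType) (a : R) r k : 0 <= a <= 1 -> 0 <= nbin a r k <= 1.
Proof.
move=> /andP[a0 a1]; have b0 : 0 <= 1 - a by rewrite subr_ge0.
apply/andP; split; first by rewrite /nbin !mulr_ge0// exprn_ge0.
elim: r k => [|r IHr] k.
  by case: k => [|k]; rewrite ?nbin0// /nbin/= mul0r mul0r.
elim: k => [|k IHk]; first by rewrite nbin0 exprn_ile1// lerBlDr lerDl.
rewrite nbin_pascal; apply: le_trans (lerD (ler_piMr a0 IHk) (ler_piMr b0 (IHr _))) _.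
by rewrite subrKC.
Qed.

(** With [a < b < 1], the weights for [b] are at most 1, and those for [a] are
smaller by a factor of order [(a / b) ^+ k]. *)
Lemma nbin_cvg0 (R : realType) (a : R) r : 0 <= a < 1 ->
  nbin a r k @[k --> \oo] --> (0 : R).
Proof.
move=> /andP[a0 a1]; have [b ab b1] : exists2 b, a < b & b < 1.
  by exists ((1 + a) / 2); lra.
have b0 : 0 < b by exact: le_lt_trans ab.
pose C := ((1 - a) / (1 - b)) ^+ r.
have bound k : 0 <= nbin a r k <= C * (a / b) ^+ k.
  have /andP[-> _]/= := nbin_le1 r k (a := a) ltac:(by rewrite a0 ltW).
  have -> : nbin a r k = nbin b r k * (C * (a / b) ^+ k).
    rewrite /nbin /C !expr_div_n.
    by field; rewrite !expf_neq0// ?subr_eq0 gt_eqF.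
  have /andP[_ le1] := nbin_le1 r k (a := b) ltac:(by rewrite !ltW).
  by rewrite ler_piMl// mulr_ge0// exprn_ge0// divr_ge0// ?subr_ge0 ltW.
apply: (@squeeze_cvgr _ _ _ _ (fun=> 0) (fun k => C * (a / b) ^+ k)).
- by near=> k; exact: bound.
- exact: cvg_cst.
- rewrite -[X in _ --> X](mulr0 C); apply: cvgMr; apply: cvg_expr.
  by rewrite ger0_norm ?divr_ge0 ?(ltW b0)// ltr_pdivrMr// mul1r.
Unshelve. all: end_near. Qed.

Section Mixture.
Variables (R : realType) (n : nat) (P : 'M[R]_n) (mu : 'rV[R]_n) (a : R).

Definition law_at (k : nat) : 'rV[R]_n := iter k (fun v => v *m P) mu.

Definition mixture (r K : nat) : 'rV[R]_n :=
  \sum_(0 <= k < K) nbin a r k *: law_at k.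

Let N : 'M[R]_n := (1 - a)^-1 *: (1%:M - a *: P).

(** Summing [nbin_pascal]: one factor [N] removes one geometric component of the
time, up to a boundary term. *)
Lemma mixtureS r K : 1 - a != 0 ->
  mixture r.+1 K.+1 *m N =
  mixture r K.+1 - (a / (1 - a) * nbin a r.+1 K) *: law_at K.+1.
Proof.
move=> a1; rewrite /N -scalemxAr mulmxBr mulmx1 -scalemxAr.
suff -> : mixture r.+1 K.+1 - a *: (mixture r.+1 K.+1 *m P) =
    (1 - a) *: mixture r K.+1 - (a * nbin a r.+1 K) *: law_at K.+1.
  rewrite scalerBr !scalerA mulVf// scale1r; congr (_ - _ *: _).
  by rewrite mulrA [_^-1 * _]mulrC.
rewrite /mixture; elim: K => [|K IHK].
  rewrite !big_nat1 -scalemxAl !nbin0 !scalerA -exprS.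
  by rewrite /law_at.
rewrite big_nat_recr// [in RHS]big_nat_recr// mulmxDl -scalemxAl nbin_pascal.
move: IHK => /rowP IHK; apply/rowP => j; move: (IHK j).
have -> : law_at K.+2 = law_at K.+1 *m P by [].
move: (\sum_(0 <= _ < _) nbin a r _ *: _) => B.
move: (law_at K.+1 *m P) => V; move: (law_at K.+1) => U.
move: (\sum_(0 <= _ < _) _) => A; move: (A *m P) => AP.
rewrite !mxE => E.
transitivity (A 0 j - a * AP 0 j +
  ((a * nbin a r.+1 K + (1 - a) * nbin a r K.+1) * (U 0 j - a * V 0 j))); first by ring.
by rewrite E; ring.
Qed.

Theorem mixture_cvg r j : 0 <= a < 1 -> N \in unitmx ->
  (forall k i, `|law_at k 0 i| <= 1) ->
  mixture r K.+1 0 j @[K --> \oo] --> iter r (fun v => v *m invmx N) mu 0 j.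
Proof.
move=> /andP[a0 a1] uN bnd.
have na1 : 1 - a != 0 by rewrite subr_eq0 gt_eqF.
elim: r j => [|r IHr] j /=.
  suff E K : mixture 0 K.+1 0 j = mu 0 j by under eq_cvg do rewrite E; exact: cvg_cst.
  rewrite /mixture big_nat_recl// big1 => [|k _]; last by rewrite /nbin/= !mul0r scale0r.
  by rewrite addr0 nbin0 expr0 scale1r.
have E K : mixture r.+1 K.+1 0 j = \sum_i (mixture r K.+1 0 i -
    a / (1 - a) * nbin a r.+1 K * law_at K.+1 0 i) * invmx N i j.
  rewrite -[mixture r.+1 _](mulmxK uN) mixtureS// [LHS]mxE.
  apply: eq_bigr => i _; congr (_ * _).
  by rewrite [LHS]mxE; congr (_ + _); rewrite [LHS]mxE; congr (- _); rewrite [LHS]mxE.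
rewrite mxE; under eq_cvg do rewrite E.
apply: (@cvg_big _ _ +%R 0 xpredT); first exact: add_continuous.
move=> i _; apply: cvgMl.
suff Z : a / (1 - a) * nbin a r.+1 K * law_at K.+1 0 i @[K --> \oo] --> 0.
  by have := cvgB (IHr i) Z; rewrite subr0; exact.
apply/norm_cvg0P.
apply: (@squeeze_cvgr _ _ _ _ (fun=> 0) (fun K => a / (1 - a) * nbin a r.+1 K)).
- near=> K; rewrite normr_ge0 andTb normrM.
  have w0 : 0 <= a / (1 - a) * nbin a r.+1 K.
    have /andP[w0 _] : 0 <= nbin a r.+1 K <= 1 by rewrite nbin_le1// a0 ltW.
    by rewrite mulr_ge0// divr_ge0// subr_ge0 ltW.
  by rewrite (ger0_norm w0) ler_piMr// bnd.
- exact: cvg_cst.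
- rewrite -[X in _ --> X](mulr0 (a / (1 - a))); apply: cvgMr.
  by apply: nbin_cvg0; rewrite a0.
Unshelve. all: end_near. Qed.
End Mixture.

(** * Functions with finitely many values *)

Section FiniteValued.
Context {d : measure_display} {T : measurableType d} {R : realType}
  {P : probability T R} {I : finType}.
Variable f : T -> I.
Hypothesis mf : forall i, measurable (f @^-1` [set i]).

Lemma finite_valued_measurable (A : set T) :
  (forall i, measurable (A `&` f @^-1` [set i])) -> measurable A.
Proof.
move=> mA; have -> : A = \bigcup_(i in [set: I]) (A `&` f @^-1` [set i]).
  by rewrite -setI_bigcupr; apply/esym/setIidPl => w _; exists (f w).
by apply: fin_bigcup_measurable => //; exact: finite_finset.
Qed.

Lemma finite_valued_measurable_fun d' (T' : measurableType d') (g : I -> T') :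
  measurable_fun setT (g \o f).
Proof.
move=> _ B mB; rewrite setTI; apply: finite_valued_measurable => i.
have [gB|gB] := pselect (B (g i)).
  by rewrite setIidr// => w /= ->.
rewrite (_ : _ `&` _ = set0)//; apply/seteqP; split => // w [/= + fi].
by rewrite fi.
Qed.

Lemma integrable_finite_valued A (g : I -> R) : measurable A ->
  P.-integrable A (fun w => (g (f w))%:E) /\
  (\int[P]_(w in A) (g (f w))%:E = \sum_i (g i)%:E * P (A `&` f @^-1` [set i]))%E.
Proof.
move=> mA.
have E w : (g (f w))%:E =
    (\sum_i (g i)%:E * (\1_(f @^-1` [set i]) w)%:E)%E.
  rewrite (bigD1 (f w))//= big1 => [|i fi].
    by rewrite adde0 indicE mem_set// mule1.
  by rewrite indicE memNset ?mule0// => /= fwi; rewrite fwi eqxx in fi.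
have int D i : measurable D ->
    P.-integrable D (fun w => (g i)%:E * (\1_(f @^-1` [set i]) w)%:E)%E.
  move=> mD; apply: integrableZl => //.
  by apply: (@integrableS _ _ _ P setT) => //; exact: integrable_indic.
split.
  apply: (@eq_integrable _ _ _ P A mA
    (fun w => \sum_i (g i)%:E * (\1_(f @^-1` [set i]) w)%:E)%E) => //.
  by apply: integrable_sum => // i _; exact: int.
under eq_integral do rewrite E.
rewrite integral_sum//; last by move=> i; exact: int.
apply: eq_bigr => i _; rewrite integralZl//; last first.
  by apply: (@integrableS _ _ _ P setT) => //; exact: integrable_indic.
by rewrite integral_indic// setIC.
Qed.

Lemma measure_finite_partition (A : set T) : measurable A ->
  P A = (\sum_i P (A `&` f @^-1` [set i]))%E.
Proof.
move=> mA; have [_] := integrable_finite_valued (fun=> 1) mA.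
by rewrite integral_cst// mul1e => ->; apply: eq_bigr => i _; rewrite mul1e.
Qed.

End FiniteValued.

(** * A Markov chain driven by one uniform variable *)

Section Cells.
Variables (R : realType) (M : nat) (k0 : 'I_M) (p : 'I_M -> R).
Hypothesis p_ge0 : forall k, 0 <= p k.
Hypothesis p_sum1 : \sum_k p k = 1.

Definition cumul (k : nat) : R := \sum_(i < M | (i < k)%N) p i.

Lemma cumulS (k : 'I_M) : cumul k.+1 = cumul k + p k.
Proof.
rewrite /cumul (bigD1 k)//= addrC; congr (_ + _).
by apply: eq_bigl => i; rewrite ltnS ltn_neqAle andbC.
Qed.

Lemma cumul_le m n : (m <= n)%N -> cumul m <= cumul n.
Proof.
move=> mn; rewrite /cumul big_mkcond [leRHS]big_mkcond; apply: ler_sum => i _.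
by case: ifPn => [im|_]; [rewrite (leq_trans im mn)|case: ifP].
Qed.

Definition in_cell (v : R) (k : 'I_M) := cumul k <= v < cumul k.+1.

Definition quantile (v : R) : 'I_M := odflt k0 [pick k | in_cell v k].

Lemma in_cell_unique v k k' : in_cell v k -> in_cell v k' -> k = k'.
Proof.
move=> /andP[a b] /andP[a' b']; apply: ord_inj; case: (ltngtP k k') => // kk.
  by have := le_lt_trans (le_trans (cumul_le kk) a') b; rewrite ltxx.
by have := le_lt_trans (le_trans (cumul_le kk) a) b'; rewrite ltxx.
Qed.

Lemma quantileP v k : 0 <= v < 1 -> (quantile v == k) = in_cell v k.
Proof.
move=> /andP[v0 v1]; rewrite /quantile; case: pickP => [k' ck'|no] /=.
  by apply/eqP/idP => [<-//|]; exact: in_cell_unique ck'.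
have ex : exists n, v < cumul n.
  exists M; rewrite /cumul (eq_bigl xpredT) ?p_sum1// => i; exact: ltn_ord.
suff [j cj] : exists j, in_cell v j by rewrite no in cj.
have [n vn nmin] := ex_minnP ex.
case: n vn nmin => [|n] vn nmin.
  by move: vn; rewrite /cumul big1 ?ltNge ?v0// => i; rewrite ltn0.
have nv : cumul n <= v.
  by rewrite leNgt; apply/negP => /nmin; rewrite ltnn.
have nM : (n < M)%N.
  rewrite ltnNge; apply/negP => Mn; have : v < cumul n; last by rewrite ltNge nv.
  rewrite /cumul (eq_bigl xpredT) ?p_sum1// => i.
  by rewrite (leq_trans (ltn_ord i)).
by exists (Ordinal nM); rewrite /in_cell/= nv vn.
Qed.

End Cells.

Section Chain.
Context {d : measure_display} {T : measurableType d} {R : realType}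
  {P : probability T R} {M : nat}.
Variables (k0 : 'I_M) (K : option 'I_M -> 'I_M -> R) (source : T -> R).
Hypothesis K_ge0 : forall z k, 0 <= K z k.
Hypothesis K_sum1 : forall z, \sum_k K z k = 1.
Hypothesis source_range : forall w, 0 <= source w < 1.
Hypothesis source_measurable : forall c, measurable [set w | source w < c].
Hypothesis source_uniform : forall c : R, 0 <= c <= 1 -> P [set w | source w < c] = c%:E.

(** The current state and a residual uniform variable.  The state [None] is the
initial value of the process, before the jump into the state space. *)
Fixpoint stage (n : nat) (w : T) : option 'I_M * R :=
  if n is m.+1 then
    let: (z, v) := stage m w in
    let k := quantile k0 (K z) v in (Some k, (v - cumul (K z) k) / K z k)
  else (None, source w).

Definition state n w := (stage n w).1.
Definition residue n w := (stage n w).2.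

Lemma stateS n w : state n.+1 w = Some (quantile k0 (K (state n w)) (residue n w)).
Proof. by rewrite /state /residue /=; case: stage. Qed.

Lemma residueS n w k : state n.+1 w = Some k ->
  residue n.+1 w = (residue n w - cumul (K (state n w)) k) / K (state n w) k.
Proof. by rewrite /state /residue /=; case: stage => z v /= [->]. Qed.

Lemma residue_range n w : 0 <= residue n w < 1.
Proof.
elim: n => [|n IHn]; first exact: source_range.
have /residueS -> := stateS n w; set z := state n w; set k := quantile _ _ _.
have : in_cell (K z) (residue n w) k by rewrite -(quantileP k0)// eqxx.
rewrite /in_cell cumulS => /andP[a b].
have K0 : 0 < K z k by have := le_lt_trans a b; rewrite ltrDl.
by rewrite divr_ge0 ?subr_ge0 ?(ltW K0)//= ltr_pdivrMr// mul1r ltrBlDl.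
Qed.

Lemma stateSP n w k : state n.+1 w = Some k <->
  cumul (K (state n w)) k <= residue n w < cumul (K (state n w)) k + K (state n w) k.
Proof.
rewrite stateS -cumulS -[_ <= _ < _]/(in_cell _ _ _).
rewrite -(quantileP k0 (K_ge0 _) (K_sum1 _))//; last exact: residue_range.
by split => [[->]//|/eqP ->].
Qed.

(** Below [c], the rescaled residue corresponds to the initial part of relative
length [c] of the cell of [k]. *)
Lemma next_below n z k c : 0 <= c <= 1 ->
  [set w | state n w = z] `&` [set w | state n.+1 w = Some k] `&`
    [set w | residue n.+1 w < c] =
  [set w | state n w = z] `&` ([set w | residue n w < cumul (K z) k + K z k * c]
    `\` [set w | residue n w < cumul (K z) k]).
Proof.
move=> /andP[c0 c1]; apply/seteqP; split => w /=.
  move=> [[zw kw]]; rewrite (residueS kw) zw => rc.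
  have /stateSP := kw; rewrite zw => /andP[a b].
  have K0 : 0 < K z k by have := le_lt_trans a b; rewrite ltrDl.
  split => //; split; last by apply/negP; rewrite -leNgt.
  by rewrite -ltrBlDl mulrC -ltr_pdivrMr.
move=> [zw [b /negP]]; rewrite -leNgt => a.
have K0 : 0 < K z k.
  rewrite lt_neqAle K_ge0 andbT; apply/negP => /eqP E.
  by have := le_lt_trans a b; rewrite -E mul0r addr0 ltxx.
have kw : state n.+1 w = Some k.
  apply/stateSP; rewrite zw a/=; apply: lt_le_trans b _.
  by rewrite lerD2l ler_piMr// ltW.
split => //; rewrite (residueS kw) zw.
by rewrite ltr_pdivrMr// ltrBlDl mulrC.
Qed.

Lemma residue_lt1 n : [set w | residue n w < 1] = setT.
Proof. by apply/seteqP; split => w //= _; have /andP[] := residue_range n w. Qed.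

Lemma next_event n z k :
  [set w | state n w = z] `&` [set w | state n.+1 w = Some k] =
  [set w | state n w = z] `&` ([set w | residue n w < cumul (K z) k + K z k]
    `\` [set w | residue n w < cumul (K z) k]).
Proof.
rewrite -[LHS]setIT -(residue_lt1 n.+1) next_below ?ler01 ?lexx//.
by rewrite mulr1.
Qed.

Lemma state_residue_measurable n :
  (forall z, measurable [set w | state n w = z]) /\
  (forall c, measurable [set w | residue n w < c]).
Proof.
elim: n => [|n [mZ mV]].
  split => [z|c]; last exact: source_measurable.
  have [->|nz] := eqVneq z None; first by rewrite (_ : mkset _ = setT)//; apply/seteqP.
  by rewrite (_ : mkset _ = set0)//; apply/seteqP; split => w //= zE; rewrite -zE in nz.
have mZ' k : measurable [set w | state n.+1 w = Some k].
  apply: (finite_valued_measurable (f := state n)) => z; rewrite setIC next_event.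
  by apply: measurableI => //; apply: measurableD.
split => [[k|]|c]; first exact: mZ'.
  by rewrite (_ : mkset _ = set0)//; apply/seteqP; split => w //=; rewrite stateS.
have [c0|c0] := leP c 0.
  rewrite (_ : mkset _ = set0)//; apply/seteqP; split => w //=.
  by have /andP[r0 _] := residue_range n.+1 w; rewrite ltNge (le_trans c0 r0).
have [c1|c1] := leP 1 c.
  rewrite (_ : mkset _ = setT)//; apply/seteqP; split => w //= _.
  by have /andP[_ r1] := residue_range n.+1 w; rewrite (lt_le_trans r1 c1).
have c01 : 0 <= c <= 1 by rewrite !ltW.
apply: (finite_valued_measurable (f := state n)) => z; rewrite setIC.
have -> : [set w | state n w = z] `&` [set w | residue n.+1 w < c] =
    \bigcup_(k in [set: 'I_M]) ([set w | state n w = z] `&`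
      [set w | state n.+1 w = Some k] `&` [set w | residue n.+1 w < c]).
  apply/seteqP; split => w /= => [[zw cw]|[k _ [[]]]//].
  by exists (quantile k0 (K (state n w)) (residue n w)); rewrite //= -stateS.
apply: fin_bigcup_measurable => [|k _]; first exact: finite_finset.
by rewrite next_below//; apply: measurableI => //; apply: measurableD.
Qed.

Lemma state_measurable n z : measurable [set w | state n w = z].
Proof. by have [+ _] := state_residue_measurable n. Qed.

Lemma residue_measurable n c : measurable [set w | residue n w < c].
Proof. by have [_] := state_residue_measurable n. Qed.

(** The events that depend only on the states numbered 0 to [n].  This recursive form says
that such an event is, on each event that the last state is [k], an event of
the past before it; inductions on [n] can use it directly, which a generated
sigma-algebra does not allow. *)
Fixpoint past (n : nat) : set (set T) :=
  if n is m.+1 then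
    [set A | forall k, exists2 B, past m B &
      A `&` [set w | state n w = Some k] = B `&` [set w | state n w = Some k]]
  else [set A | A = set0 \/ A = setT].

Lemma past_setT n : past n setT.
Proof. by elim: n => [|n IHn]; [right|move=> k; exists setT]. Qed.

Lemma past_setC n A : past n A -> past n (~` A).
Proof.
elim: n A => [|n IHn] A /=.
  by case=> ->; [right; rewrite setC0|left; rewrite setCT].
move=> pA k; have [B /IHn pB AB] := pA k; exists (~` B) => //.
move/seteqP: AB => [sAB sBA]; apply/seteqP.
split=> w [nA wk]; split => // Aw; apply: nA.
  by have [] := sBA w (conj Aw wk).
by have [] := sAB w (conj Aw wk).
Qed.

Lemma past_bigcup n (F : nat -> set T) :
  (forall i, past n (F i)) -> past n (\bigcup_i F i).
Proof.
elim: n F => [|n IHn] F /= pF.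
  have [[i Fi]|nF] := pselect (exists i, F i = setT).
    by right; apply/seteqP; split => // w _; exists i => //; rewrite Fi.
  left; rewrite bigcup0// => i _; have [//|FT] := pF i.
  by case: nF; exists i.
move=> k; have /choice[B HB] i : exists B, past n B /\
    F i `&` [set w | state n.+1 w = Some k] = B `&` [set w | state n.+1 w = Some k].
  by have [B ? ?] := pF i k; exists B.
exists (\bigcup_i B i); first by apply: IHn => i; have [] := HB i.
by rewrite !setI_bigcupl; apply: eq_bigcup => // i _; have [] := HB i.
Qed.

Lemma past_setI n A B : past n A -> past n B -> past n (A `&` B).
Proof.
elim: n A B => [|n IHn] A B /=.
  by case=> ->; rewrite ?set0I ?setTI //; left.
move=> pA pB k; have [A' pA' AE] := pA k; have [B' pB' BE] := pB k.
exists (A' `&` B'); first exact: IHn.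
by rewrite setIIl AE BE -setIIl.
Qed.

Lemma past_sigma_algebra n : sigma_algebra setT (past n).
Proof.
split; first by rewrite -setCT; apply/past_setC/past_setT.
- by move=> A pA; rewrite setTD; exact: past_setC.
- exact: past_bigcup.
Qed.

Lemma past_le m n : (m <= n)%N -> past m `<=` past n.
Proof.
elim: n m => [|n IHn] m; first by rewrite leqn0 => /eqP ->.
rewrite leq_eqVlt => /orP[/eqP -> //|]; rewrite ltnS => /IHn mn A /mn pA k.
by exists A.
Qed.

Lemma past_set0 n : past n set0.
Proof. by have [] := past_sigma_algebra n. Qed.

Lemma past_const n (Q : Prop) : past n [set w | Q].
Proof.
have [q|q] := pselect Q.
  suff -> : [set w | Q] = setT :> set T by exact: past_setT.
  by apply/seteqP; split.
suff -> : [set w | Q] = set0 :> set T by exact: past_set0.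
by apply/seteqP; split.
Qed.

Lemma past_state m n (Q : option 'I_M -> Prop) : (m <= n)%N ->
  past n [set w | Q (state m w)].
Proof.
move=> mn; apply: (past_le mn); case: m {mn} => [|m].
  exact: (past_const 0 (Q None)).
move=> k; exists [set w | Q (Some k)]; first exact: (past_const m (Q (Some k))).
by apply/seteqP; split => w /= [+ wk]; rewrite wk.
Qed.

Lemma past_measurable n A : past n A -> measurable A.
Proof.
elim: n A => [|n IHn] A /=; first by case=> ->.
move=> pA; apply: (finite_valued_measurable (f := state n.+1)) => -[k|].
  have [B /IHn mB AB] := pA k.
  have -> : A `&` state n.+1 @^-1` [set Some k] =
      B `&` [set w | state n.+1 w = Some k] by exact: AB.
  by apply: measurableI mB _; exact: state_measurable.
rewrite (_ : _ `&` _ = set0)//; apply/seteqP; split => w //= [_].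
by rewrite stateS.
Qed.

Definition draw n w := quantile k0 (K (state n w)) (residue n w).

Lemma draw_fiber n z k :
  (fun w => (state n w, draw n w)) @^-1` [set (z, k)] =
  [set w | state n w = z] `&` [set w | state n.+1 w = Some k].
Proof.
apply/seteqP; split => w; rewrite /mkset /preimage /= ?stateS -/(draw n w).
  by case=> zw kw; split => //=; congr Some.
by case=> /= <- [<-].
Qed.

Lemma draw_measurable n q :
  measurable ((fun w => (state n w, draw n w)) @^-1` [set q]).
Proof.
by case: q => z k; rewrite draw_fiber; apply: measurableI; exact: state_measurable.
Qed.

(** One step of the construction: given the past and the state [z], the residue is
uniform, so that it falls into a part of length [K z k * c] with this
probability. *)
Lemma next_prob n A z k c :
  (forall B c, past n B -> 0 <= c <= 1 ->
     P (B `&` [set w | residue n w < c]) = (P B * c%:E)%E) ->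
  past n A -> 0 <= c <= 1 ->
  P (A `&` ([set w | state n w = z] `&` [set w | state n.+1 w = Some k] `&`
       [set w | residue n.+1 w < c])) =
  (P (A `&` [set w | state n w = z]) * (K z k * c)%:E)%E.
Proof.
move=> unif pA c01; rewrite next_below// setIA.
have pC : past n (A `&` [set w | state n w = z]).
  by apply: past_setI => //; exact: (past_state (fun z' => z' = z)).
move: (A `&` _) pC => C pC; have mC := past_measurable pC.
have Kc0 : 0 <= K z k * c by rewrite mulr_ge0//; case/andP: c01.
have cu0 : 0 <= cumul (K z) k by rewrite sumr_ge0.
have cu1 : cumul (K z) k + K z k * c <= 1.
  rewrite -(K_sum1 z) (_ : \sum_k K z k = cumul (K z) M); last first.
    by apply: eq_bigl => i; rewrite ltn_ord.
  apply: le_trans (cumul_le (K_ge0 z) (ltn_ord k)); rewrite cumulS lerD2l.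
  by rewrite ler_piMr//; case/andP: c01.
have cu2 : cumul (K z) k <= 1 by apply: le_trans cu1; rewrite lerDl.
set X := mkset _; set Y := mkset _.
have mX : measurable X by exact: residue_measurable.
have mY : measurable Y by exact: residue_measurable.
have -> : C `&` (X `\` Y) = (C `&` X) `\` (C `&` Y).
  by apply/seteqP; split => w /=; [move=> [? [? nY]]; split => // -[]|
    move=> [[? ?] nCY]; split => //; split => // ?; apply: nCY].
have XY : C `&` X `&` (C `&` Y) = C `&` Y.
  apply/seteqP; split => w /=; first by case.
  move=> [Cw Yw]; split => //; split => //.
  by apply: lt_le_trans Yw _; rewrite lerDl.
transitivity (P (C `&` X) - P (C `&` Y))%E.
  rewrite measureD; [by rewrite XY|exact: measurableI|exact: measurableI|].
  by rewrite ltey_eq fin_num_measure//; exact: measurableI.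
rewrite !unif// ?cu0 ?cu2// ?cu1 ?andbT ?addr_ge0//.
have : P C \is a fin_num by rewrite fin_num_measure.
case: (P C) => // x _; rewrite -!EFinM -EFinB; congr EFin; ring.
Qed.

(** The residue is uniform and independent of the past.  Splitting along the last
two states, [next_prob] multiplies each term by the same factor [c]. *)
Lemma residue_uniform n A c : past n A -> 0 <= c <= 1 ->
  P (A `&` [set w | residue n w < c]) = (P A * c%:E)%E.
Proof.
elim: n A c => [|n IHn] A c.
  case=> -> c01; first by rewrite set0I measure0 mul0e.
  by rewrite setTI source_uniform// probability_setT mul1e.
move=> pA c01; have mA := past_measurable pA.
rewrite (measure_finite_partition (draw_measurable n)); last first.
  by apply: measurableI => //; exact: residue_measurable.
rewrite (measure_finite_partition (draw_measurable n) mA).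
rewrite ge0_sume_distrl//; apply: eq_bigr => -[z k] _; rewrite draw_fiber.
have [B pB AB] := pA k.
have E c' : A `&` ([set w | state n w = z] `&` [set w | state n.+1 w = Some k]
      `&` [set w | residue n.+1 w < c']) =
    B `&` ([set w | state n w = z] `&` [set w | state n.+1 w = Some k]
      `&` [set w | residue n.+1 w < c']).
  rewrite -!setIA !(setICA _ [set w | state n w = z]); congr (_ `&` _).
  by rewrite !setIA AB.
rewrite -setIA [[set w | residue _ w < c] `&` _]setIC E next_prob//.
rewrite -[X in (P (A `&` X))]setIT -(residue_lt1 n.+1) E next_prob ?ler01 ?lexx//.
by rewrite mulr1 EFinM muleA.
Qed.

(** The case [c = 1] of [next_prob]: the residue is always below 1. *)
Theorem markov_transition n A z k : past n A ->
  P (A `&` [set w | state n w = z] `&` [set w | state n.+1 w = Some k]) =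
  (P (A `&` [set w | state n w = z]) * (K z k)%:E)%E.
Proof.
move=> pA; rewrite -setIA -[X in P (A `&` X)]setIT -(residue_lt1 n.+1).
by rewrite next_prob ?ler01 ?lexx ?mulr1//; exact: residue_uniform.
Qed.

End Chain.

(** * The jump into the state space *)

Section Jump.
Variables (R : realType) (M : nat) (s : 'I_M -> R).
Hypothesis s_incr : forall j k : 'I_M, (j < k)%N -> s j < s k.
Variables (j0 j1 : 'I_M) (y : R).
Hypothesis y_gt : s j0 < y.
Hypothesis y_lt : y < s j1.
Hypothesis j1E : j1.+1 = M.

Lemma jump_prob_ge0 j : 0 <= jump_prob s y j.
Proof.
rewrite /jump_prob; case: ifP => // _; case: ifP => [/andP[a b]|_].
  by rewrite divr_ge0// subr_ge0 ltW// (lt_trans a).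
case: ifP => // /andP[a b].
by rewrite divr_ge0// subr_ge0 ltW// (lt_trans a).
Qed.

Lemma jump_location : exists l : 'I_M, (l.+1 < M)%N /\ s l <= y < s (nxt l).
Proof.
have j0y : s j0 <= y by exact: ltW.
have [l ly lmax] := @arg_maxnP _ j0 (fun j => s j <= y) val j0y.
have lM : (l.+1 < M)%N.
  rewrite ltn_neqAle ltn_ord andbT; apply/eqP => E.
  have lj1 : l = j1 by apply: val_inj; apply: succn_inj; rewrite E j1E.
  by move: ly; rewrite lj1 leNgt y_lt.
exists l; split => //; rewrite ly/= ltNge; apply/negP => /lmax.
by rewrite /= val_nxt// ltnn.
Qed.

(** The jump replaces [y] by the two neighbouring states, with the weights of
linear interpolation; [l] is the greatest index with [s l <= y], and the
second weight is 0 if [y = s l]. *)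
Lemma jump_prob_interpolates : exists l : 'I_M, [/\ (l.+1 < M)%N, s l <= y < s (nxt l) &
  forall g : 'I_M -> R, \sum_j jump_prob s y j * g j =
    (s (nxt l) - y) / (s (nxt l) - s l) * g l +
    (y - s l) / (s (nxt l) - s l) * g (nxt l)].
Proof.
have [l [lM /andP[ly yn]]] := jump_location.
exists l; split => //; first by rewrite ly yn.
have nl := val_nxt lM.
have D0 : s (nxt l) - s l != 0 by rewrite gt_eqF// subr_gt0 (le_lt_trans ly).
have nl_l : nxt l != l by rewrite -val_eqE /= nl gtn_eqF.
move=> g; rewrite (bigD1 l)//= (bigD1 (nxt l))//= big1 ?addr0 => [|j /andP[jl jn]].
  congr (_ * _ + _ * _); rewrite /jump_prob.
    have [<-|nyl] := eqVneq y (s l); first by rewrite divff// subr_eq0 gt_eqF.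
    have ly' : s l < y by rewrite lt_neqAle eq_sym nyl.
    by rewrite [y < s l]ltNge ly andbF ly' yn.
  have pn : prv (nxt l) = l by apply: val_inj; rewrite /= val_prv nl.
  rewrite (lt_eqF yn) pn yn andbT [s (nxt l) < y]ltNge (ltW yn)/=.
  have [//|yl] := ltP (s l) y.
  by rewrite (le_anti (introT andP (conj ly yl))) subrr mul0r.
suff -> : jump_prob s y j = 0 by rewrite mul0r.
rewrite /jump_prob; have [jl'|lj|/val_inj E] := ltngtP j l; last by rewrite E eqxx in jl.
  have sj : s j < y by apply: lt_le_trans ly; exact: s_incr.
  have jM : (j.+1 < M)%N by apply: leq_trans lM; rewrite ltnS ltnW.
  have sn : s (nxt j) <= y.
    by apply: le_trans ly; apply: s_nondecreasing => //; rewrite val_nxt.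
  by rewrite gt_eqF// [y < s j]ltNge (ltW sj) andbF [y < s (nxt j)]ltNge sn andbF.
have nj : (nxt l < j)%N.
  rewrite ltn_neqAle nl lj andbT; apply: contra jn => /eqP E.
  by apply/eqP/val_inj; rewrite /= nl E.
have sj : y < s j by apply: lt_trans yn _; exact: s_incr.
have sp : y <= s (prv j).
  by apply: le_trans (ltW yn) _; apply: s_nondecreasing => //; rewrite val_prv; case: (nat_of_ord j) nj.
by rewrite lt_eqF// [_ < y]ltNge sp/= [s j < y]ltNge (ltW sj).
Qed.

Lemma jump_prob_affine (a b : R) : \sum_j jump_prob s y j * (a * s j + b) = a * y + b.
Proof.
have [l [lM /andP[ly yn] ->]] := jump_prob_interpolates.
have D0 : s (nxt l) - s l != 0 by rewrite gt_eqF// subr_gt0 (le_lt_trans ly).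
by field.
Qed.

Lemma jump_prob_sum1 : \sum_j jump_prob s y j = 1.
Proof.
rewrite -[RHS]add0r -[X in X + _](mul0r y) -jump_prob_affine.
by apply: eq_bigr => j _; rewrite mul0r add0r mulr1.
Qed.

Lemma jump_prob_expect : \sum_j jump_prob s y j * s j = y.
Proof.
rewrite -[RHS]mul1r -[RHS]addr0 -jump_prob_affine.
by apply: eq_bigr => j _; rewrite mul1r addr0.
Qed.

(** The payoff is linear between neighbouring states, so the jump keeps its
mean. *)
Lemma jump_prob_call j : \sum_k jump_prob s y k * call_payoff s j k = Num.max (y - s j) 0.
Proof.
have [l [lM /andP[ly yn] ->]] := jump_prob_interpolates.
have D0 : s (nxt l) - s l != 0 by rewrite gt_eqF// subr_gt0 (le_lt_trans ly).
have [jl|lj] := leqP j l.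
  have sjl : s j <= s l by exact: s_nondecreasing.
  have sjn : s j <= s (nxt l) by rewrite (le_trans sjl)// (le_trans ly)// ltW.
  rewrite /call_payoff !max_l ?subr_ge0// ?(le_trans sjl)//; by field.
have snj : s (nxt l) <= s j by apply: s_nondecreasing => //; rewrite val_nxt.
have yj : y <= s j by rewrite (le_trans (ltW yn)).
rewrite /call_payoff !max_r ?subr_le0// ?(le_trans ly)//.
by rewrite !mulr0 addr0.
Qed.

End Jump.

(** The change of clock between the discrete time chain and the rates [l]. *)
Lemma resolvent_invZ (R : realType) (M : nat) (s q : 'I_M -> R) (a : R) :
  1 - a != 0 ->
  (1 - a)^-1 *: (1%:M - a *: dmrw_matrix s q) =
  resolvent_inv s (fun j => a / (1 - a) * q j).
Proof.
move=> a1; apply/matrixP => j k; rewrite !mxE [j == k]eq_sym.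
case: eqP => _; first by rewrite !mulr1n; field.
rewrite mulr0n; case: ifP => _; last case: ifP => _; last by rewrite !(mulr0, subr0).
  by move: ((s (nxt j) - s j) / _) => c; field.
by move: ((s j - s (prv j)) / _) => c; field.
Qed.

(** * The martingale random walk *)

(** Keeps the uniform variable inside [[0, 1[] everywhere, instead of almost
everywhere, so that all the states of the chain are defined at each point. *)
Definition clip (R : realType) (x : R) : R := if 0 <= x < 1 then x else 0.

Lemma clip_range (R : realType) (x : R) : 0 <= clip x < 1.
Proof. by rewrite /clip; case: ifP => // _; rewrite lexx ltr01. Qed.

Lemma clip_lt (R : realType) (c : R) :
  [set x | clip x < c] = if 0 < c then ~` `[c, 1[%classic else set0.
Proof.
have [c0|c0] := ltP 0 c; apply/seteqP; split => x //=.
- rewrite in_itv/= /clip => xc /andP[cx x1]; move: xc.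
  by rewrite (le_trans (ltW c0) cx) x1 ltNge cx.
- move=> /negP; rewrite in_itv/= /clip negb_and; case: ifP => [/andP[x0 x1]|//].
  by rewrite x1 orbF -ltNge.
- by have /andP[x0 _] := clip_range x; rewrite ltNge (le_trans c0 x0).
Qed.

Lemma clip_measurable (R : realType) (c : R) :
  measurable ([set x | clip x < c] : set (measurableTypeR R)).
Proof.
by rewrite clip_lt; case: ifP => _ //; apply: measurableC; exact: measurable_itv.
Qed.

Lemma uniform_clip (R : realType) (c : R) : 0 <= c <= 1 ->
  uniform_prob (@ltr01 R) [set x | clip x < c] = c%:E.
Proof.
move=> /andP[c0 c1]; rewrite clip_lt.
have [cp|c0'] := ltP 0 c; last first.
  by rewrite measure0; congr EFin; apply/eqP; rewrite eq_le c0 c0'.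
pose I := `[c, 1[%classic : set R; rewrite -/I.
have -> : uniform_prob (@ltr01 R) (~` I) = (1 - uniform_prob (@ltr01 R) I)%E.
  by apply: (@probability_setC _ _ _ (uniform_prob (@ltr01 R))); exact: measurable_itv.
suff -> : uniform_prob (@ltr01 R) I = (1 - c)%:E.
  by rewrite -EFinB; congr EFin; ring.
rewrite /I /uniform_prob (eq_integral (fun=> 1%:E)); last first.
  move=> x; rewrite inE/= in_itv/= /uniform_pdf => /andP[cx x1].
  by rewrite (le_trans c0 cx) (ltW x1)/= subr0 invr1.
rewrite integral_cst//= mul1e lebesgue_measure_itv/= lte_fin.
by case: ltP => [_|c1']; rewrite ?EFinB//; congr EFin; lra.
Qed.

Lemma rv_of d (T : measurableType d) (R : realType) (P : probability T R)
    d' (T' : measurableType d') (f : T -> T') :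
  measurable_fun setT f -> exists g : {RV P >-> T'}, forall w, g w = f w.
Proof.
move=> mf.
by exists (HB.pack f (isMeasurableFun.Build _ _ _ _ f mf) : {mfun T >-> T'}).
Qed.

(** Shows that a chain driven by the second factor of a product depends on that
factor only. *)
Lemma stage_comp d (T : measurableType d) d' (T' : measurableType d')
    (R : realType) M (k0 : 'I_M) (K : option 'I_M -> 'I_M -> R) (V : T' -> R)
    (g : T -> T') n w :
  stage k0 K (V \o g) n w = stage k0 K V n (g w).
Proof. by elim: n => //= n ->. Qed.

Section Kernel.
Variables (R : realType) (M : nat) (s q : 'I_M -> R).
Hypothesis s_incr : forall j k : 'I_M, (j < k)%N -> s j < s k.
Hypothesis q_unit : forall j, 0 <= q j <= 1.
Hypothesis q_ends : vanishes_at_ends q.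
Variables (j0 j1 : 'I_M) (e : R).
Hypothesis e_gt : s j0 < e.
Hypothesis e_lt : e < s j1.
Hypothesis j1E : j1.+1 = M.

(** The immediate jump is the transition out of the state [None]. *)
Definition dmrw_kernel (z : option 'I_M) (k : 'I_M) : R :=
  if z is Some j then dmrw_matrix s q j k else jump_prob s e k.

Definition position (z : option 'I_M) : R := if z is Some j then s j else e.

Lemma dmrw_kernel_ge0 z k : 0 <= dmrw_kernel z k.
Proof.
case: z => [j|] /=; last exact: jump_prob_ge0.
have /andP[q0 q1] := q_unit j.
rewrite mxE; case: ifP => _; first by rewrite subr_ge0.
case: ifP => [/andP[ij _]|_].
  have a := prv_lt s_incr ij; have b := nxt_lt s_incr ij.
  by rewrite mulr_ge0// divr_ge0// subr_ge0 ltW// (lt_trans a).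
case: ifP => // /andP[ij _].
have a := prv_lt s_incr ij; have b := nxt_lt s_incr ij.
by rewrite mulr_ge0// divr_ge0// subr_ge0 ltW// (lt_trans a).
Qed.

Lemma dmrw_kernel_affine (a b : R) z :
  \sum_k dmrw_kernel z k * (a * s k + b) = a * position z + b.
Proof.
case: z => [j|] /=; last exact: (jump_prob_affine s_incr e_gt e_lt).
by rewrite dmrw_matrix_action// generator_affine// mulr0 addr0.
Qed.

Lemma dmrw_kernel_sum1 z : \sum_k dmrw_kernel z k = 1.
Proof.
rewrite -[RHS]add0r -[X in X + _](mul0r (position z)) -dmrw_kernel_affine.
by apply: eq_bigr => j _; rewrite mul0r add0r mulr1.
Qed.

Lemma dmrw_kernel_expect z : \sum_k dmrw_kernel z k * s k = position z.
Proof.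
rewrite -[RHS]mul1r -[RHS]addr0 -dmrw_kernel_affine.
by apply: eq_bigr => j _; rewrite mul1r addr0.
Qed.

Section Process.
Context {d : measure_display} {T : measurableType d} {P : probability T R}.
Variable V : T -> R.
Hypothesis V_range : forall w, 0 <= V w < 1.
Hypothesis V_measurable : forall c, measurable [set w | V w < c].
Hypothesis V_uniform : forall c : R, 0 <= c <= 1 -> P [set w | V w < c] = c%:E.
Let Z := state j0 dmrw_kernel V.
Let K0 := dmrw_kernel_ge0.
Let K1 := dmrw_kernel_sum1.
Variables (X0 : {RV P >-> R}) (X : nat -> {RV P >-> R}).
Hypothesis X0E : forall w, X0 w = e.
Hypothesis XE : forall n w, X n w = position (Z n.+1 w).

Lemma with_startE n w : with_start X0 X n w = position (Z n w).
Proof. by case: n => [|n] /=; rewrite ?X0E ?XE. Qed.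

Lemma history_past n : history (with_start X0 X) n `<=` past j0 dmrw_kernel V n.
Proof.
apply: smallest_sub; first exact: past_sigma_algebra.
apply: (big_ind (fun S => S `<=` past j0 dmrw_kernel V n)) => //.
  by move=> A B sA sB S [/sA|/sB].
move=> i _ _ [B mB <-]; rewrite setTI.
rewrite (_ : _ @^-1` B = [set w | B (position (Z i w))]).
  by apply: (past_state _ _ _ (fun z => B (position z))); rewrite -ltnS.
by apply/seteqP; split => w; rewrite /preimage/= with_startE.
Qed.

Lemma position_Some t j :
  X t @^-1` [set s j] = [set w | Z t.+1 w = Some j].
Proof.
have s_inj : injective s.
  move=> a b sab; apply: val_inj; case: (ltngtP a b) => // ab;
    by have := s_incr ab; rewrite sab ltxx.
apply/seteqP; split => w /=; rewrite XE /Z stateS /=; first by move=> /s_inj ->.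
by case=> ->.
Qed.

(** The expectation, on an event of the past, of a function of two successive
states; a transition is averaged out by the kernel. *)
Lemma integral_state_draw n A (g : option 'I_M * 'I_M -> R) :
  past j0 dmrw_kernel V n A ->
  (\int[P]_(w in A) (g (Z n w, draw j0 dmrw_kernel V n w))%:E =
   (\sum_z fine (P (A `&` [set w | Z n w = z])) *
      \sum_k dmrw_kernel z k * g (z, k))%:E)%E.
Proof.
move=> pA; have mA := past_measurable K0 K1 V_range V_measurable pA.
have [_ ->] := integrable_finite_valued (P := P)
  (draw_measurable j0 K0 K1 V_range V_measurable n) g mA.
under [in RHS]eq_bigr do rewrite mulr_sumr.
rewrite pair_big/= -sumEFin; apply: eq_bigr => -[z k] _ /=.
rewrite draw_fiber setIA markov_transition//.
have : P (A `&` [set w | state j0 dmrw_kernel V n w = z]) \is a fin_num.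
  apply: fin_num_measure; apply: measurableI => //; exact: state_measurable.
by rewrite /Z; case: (P _) => //= x _; rewrite -!EFinM; congr EFin; ring.
Qed.

(** The kernel preserves the mean, also for the immediate jump. *)
Lemma martingale_step n A : past j0 dmrw_kernel V n A ->
  (\int[P]_(w in A) (with_start X0 X n.+1 w)%:E =
   \int[P]_(w in A) (with_start X0 X n w)%:E)%E.
Proof.
move=> pA; under eq_integral do rewrite with_startE /Z stateS -/(draw _ _ _ _ _).
rewrite (integral_state_draw (fun q => s q.2) pA).
under [RHS]eq_integral do rewrite with_startE.
rewrite (integral_state_draw (fun q => position q.1) pA).
congr EFin; apply: eq_bigr => z _; congr (_ * _).
by rewrite /= dmrw_kernel_expect -mulr_suml dmrw_kernel_sum1 mul1r.
Qed.

Lemma dmrw_process : dmrw s q X0 X.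
Proof.
have mark := @markov_transition _ _ _ P _ j0 _ _ K0 K1 V_range V_measurable V_uniform.
split.
- by move=> w; exists j0, j1; rewrite X0E !ltW.
- by move=> t w; rewrite XE /Z stateS /=; eexists.
- move=> B j mB; rewrite position_Some.
  have -> : X0 @^-1` B = [set _ | B e].
    by apply/seteqP; split => w; rewrite /preimage/= X0E.
  have pB : past j0 dmrw_kernel V 0 [set _ | B e] by exact: past_const.
  have := mark 0%N _ None j pB.
  rewrite (_ : [set w | state _ _ _ 0 w = None] = setT); last by apply/seteqP.
  rewrite setIT => ->; rewrite (eq_integral (fun=> (jump_prob s e j)%:E)); last first.
    by move=> w _; rewrite X0E.
  rewrite integral_cst 1?muleC//; exact: past_measurable pB.
- move=> t A j k hA; rewrite !position_Some.
  by apply: mark; exact: history_past.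
- split.
    move=> n.
    have [intX _] := integrable_finite_valued (P := P)
      (state_measurable j0 K0 K1 V_range V_measurable n) position measurableT.
    by apply: eq_integrable intX => // w _; rewrite with_startE.
  move=> n A hA; exact: martingale_step (history_past hA).
Qed.

Lemma state_law n j : P [set w | Z n.+1 w = Some j] =
  (law_at (dmrw_matrix s q) (\row_k jump_prob s e k) n 0 j)%:E.
Proof.
have mark := @markov_transition _ _ _ P _ j0 _ _ K0 K1 V_range V_measurable V_uniform.
elim: n j => [|n IHn] j.
  have := mark 0%N setT None j (past_setT _ _ _ _).
  rewrite !setTI (_ : [set w | state _ _ _ 0 w = None] = setT); last by apply/seteqP.
  by rewrite setTI probability_setT mul1e /= mxE.
have fE i : draw j0 dmrw_kernel V n @^-1` [set i] = [set w | Z n.+1 w = Some i].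
  apply/seteqP; split => w; rewrite /Z /preimage/= stateS -/(draw _ _ _ _ _).
    by move=> ->.
  by case.
rewrite (measure_finite_partition (f := draw j0 dmrw_kernel V n)); last 2 first.
- by move=> i; rewrite fE; exact: state_measurable.
- exact: state_measurable.
rewrite /= mxE -sumEFin; apply: eq_bigr => i _.
rewrite fE setIC -[X in (X `&` _)%classic]setTI mark; last exact: past_setT.
by rewrite setTI IHn.
Qed.

End Process.
End Kernel.

(** * Independence of the time *)

Section Product.
Variables (R : realType) (M : nat) (s q : 'I_M -> R).
Hypothesis s_incr : forall j k : 'I_M, (j < k)%N -> s j < s k.
Hypothesis q_unit : forall j, 0 <= q j <= 1.
Hypothesis q_ends : vanishes_at_ends q.
Variables (j0 j1 : 'I_M) (e : R).
Hypothesis e_gt : s j0 < e.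
Hypothesis e_lt : e < s j1.
Hypothesis j1E : j1.+1 = M.
Context {d : measure_display} {T : measurableType d} {P : probability T R}.
Variable tau : {RV P >-> nat}.

Context {d2 : measure_display} {T2 : measurableType d2} {U : probability T2 R}.
Variable v : T2 -> R.
Hypothesis v_range : forall x, 0 <= v x < 1.
Hypothesis v_measurable : forall c, measurable [set x | v x < c].
Hypothesis v_uniform : forall c : R, 0 <= c <= 1 -> U [set x | v x < c] = c%:E.

Let P' : probability (T * T2)%type R := (P \x U)%E.
Let K := dmrw_kernel s q e.
Let K0 : forall z k, 0 <= K z k.
Proof. exact: dmrw_kernel_ge0. Qed.
Let K1 : forall z, \sum_k K z k = 1.
Proof. by move=> z; apply: (dmrw_kernel_sum1 s_incr q_ends e_gt e_lt). Qed.
Let V : T * T2 -> R := v \o snd.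

Lemma product_rectangle (A : set T) (B : set T2) : measurable A -> measurable B ->
  P' (A `*` B) = (P A * U B)%E.
Proof. exact: product_measure1E. Qed.

Lemma product_snd (B : set T2) : measurable B ->
  P' (snd @^-1` B) = U B.
Proof.
move=> mB; rewrite (_ : snd @^-1` B = setT `*` B); last by apply/seteqP; split => w //= [].
by rewrite product_rectangle// probability_setT mul1e.
Qed.

Lemma product_fst (A : set T) : measurable A -> P' (fst @^-1` A) = P A.
Proof.
move=> mA; rewrite (_ : fst @^-1` A = A `*` setT); last by apply/seteqP; split => w //= [].
by rewrite product_rectangle// probability_setT mule1.
Qed.

Lemma product_source_measurable c : measurable [set w | V w < c].
Proof.
rewrite -[X in measurable X]setTI.
exact: (measurable_snd measurableT _ (v_measurable c)).
Qed.

Lemma product_source_uniform c : 0 <= c <= 1 -> P' [set w | V w < c] = c%:E.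
Proof.
by move=> c01; rewrite -(v_uniform c01) -product_snd.
Qed.

Let Z n w := state j0 K V n w.

Lemma state_snd n w : Z n w = state j0 K v n w.2.
Proof. by rewrite /Z /state -(stage_comp j0 K v (snd : T * T2 -> T2)). Qed.

Lemma source_chain_measurable n z : measurable [set x | state j0 K v n x = z].
Proof. exact: state_measurable. Qed.

(** The events of the process depend on the second factor only, and those of the
time on the first. *)
Lemma product_independent (X0 : {RV P' >-> R}) (X : nat -> {RV P' >-> R})
    (tau' : {RV P' >-> nat}) :
  (forall w, X0 w = e) -> (forall n w, X n w = position s e (Z n.+1 w)) ->
  (forall w, tau' w = tau w.1) ->
  independent_time tau' (with_start X0 X).
Proof.
move=> X0E XE tauE A k sA.
have [B mB <-] : preimage_set_system setT (snd : T * T2 -> T2) measurable A.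
  move: A sA; apply: smallest_sub.
    by apply: sigma_algebra_preimage; exact: sigma_algebra_measurable.
  move=> _ [n _ [B mB <-]]; rewrite !setTI.
  exists [set x | B (position s e (state j0 K v n x))].
    rewrite -[X in measurable X]setTI.
    exact: (finite_valued_measurable_fun (f := state j0 K v n)
      (source_chain_measurable n) (position s e)).
  rewrite setTI; apply/seteqP; split => w; rewrite /preimage/=.
    by rewrite (with_startE X0E XE) -/(Z _ _) state_snd.
  by rewrite (with_startE X0E XE) -/(Z _ _) state_snd.
rewrite setTI.
have mt : measurable (tau @^-1` [set k]).
  by rewrite -[X in measurable X]setTI; exact: measurable_funP.
have -> : tau' @^-1` [set k] = fst @^-1` (tau @^-1` [set k]).
  by apply/seteqP; split => w; rewrite /preimage/= tauE.
rewrite product_snd// product_fst// muleC -product_rectangle//.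
by congr (P' _); apply/seteqP; split => w /= [].
Qed.

End Product.

(** * The law at the random time *)

(** Split along the value of the time. *)
Lemma stopped_law (R : realType) (d : measure_display) (T : measurableType d)
    (P : probability T R) (tau : {RV P >-> nat}) (Y : nat -> {RV P >-> R})
    (X : nat -> {RV P >-> R}) (x : R) (pi u : nat -> R) (l : R) :
  independent_time tau Y ->
  (forall k, sigma_process Y (X k @^-1` [set x])) ->
  (forall k, P (tau @^-1` [set k]) = (pi k)%:E) ->
  (forall k, P (X k @^-1` [set x]) = (u k)%:E) ->
  \sum_(0 <= k < n.+1) pi k * u k @[n --> \oo] --> l ->
  P [set w | X (tau w) w = x] = l%:E.
Proof.
move=> ind sX tauE XE lim.
have mtau k : measurable (tau @^-1` [set k]).
  by rewrite -[X in measurable X]setTI; exact: measurable_funP.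
have mX k : measurable (X k @^-1` [set x]).
  by rewrite -[X in measurable X]setTI; exact: measurable_funP.
have -> : [set w | X (tau w) w = x] =
    \bigcup_k (X k @^-1` [set x] `&` tau @^-1` [set k]).
  apply/seteqP; split => w /=; first by exists (tau w).
  by move=> [k _ /= [Xw ->]].
rewrite measure_bigcup//; last 2 first.
- by move=> k _; exact: measurableI.
- by move=> i j _ _ [w /= [[_ <-] [_ <-]]].
apply: cvg_lim => //.
rewrite -cvg_shiftS.
rewrite (_ : (fun n => _) = (fun n => (\sum_(0 <= k < n.+1) pi k * u k)%:E)).
  by apply: cvg_EFin => //; exact: nearW.
apply/funext => n; rewrite /= -sumEFin; apply: eq_big => [k|k _]; first by rewrite in_setT.
by rewrite ind// tauE XE -EFinM mulrC.
Qed.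

Theorem theorem2p6 (R : realType) (M : nat) (hM : (2 <= M)%N)
  (s : 'I_M -> R) (hs : forall j k : 'I_M, (j < k)%N -> s j < s k)
  (p : 'I_M -> R) (hp : forall j, 0 < p j) (hp1 : \sum_(j < M) p j = 1)
  (r : nat) (hr : (1 <= r)%N) :
  let e0 := \sum_(j < M) s j * p j in
  exists a0 : R, 0 <= a0 < 1 /\
  forall a : R, a0 <= a < 1 ->
  forall (d : measure_display) (T : measurableType d) (P : probability T R)
    (tau : {RV P >-> nat}),
  (forall k : nat, P (tau @^-1` [set k]) =
     ('C((r + k).-1, r.-1)%:R * (1 - a) ^+ r * a ^+ k)%:E) ->
  exists q : 'I_M -> R,
    (forall j, (inner j -> 0 < q j <= 1) /\ (~~ inner j -> q j = 0)) /\
    (* P' extends the probability space of tau, through proj *)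
    exists (d' : measure_display) (T' : measurableType d')
      (P' : probability T' R) (proj : {RV P' >-> T}) (tau' : {RV P' >-> nat})
      (X0 : {RV P' >-> R}) (X : nat -> {RV P' >-> R}),
    [/\ (forall A, measurable A -> P' (proj @^-1` A) = P A),
        (forall w, tau' w = tau (proj w)),
        dmrw s q X0 X,
        independent_time tau' (with_start X0 X) &
        (0 < P' [set w | X0 w = e0])%E /\
        forall j, cond_prob P' [set w | X (tau' w) w = s j]
                               [set w | X0 w = e0] = p j].
Proof.
move=> e0.
have M0 : (0 < M)%N by exact: leq_trans hM.
have M1 : (M.-1 < M)%N by rewrite prednK.
pose j0 := Ordinal M0; pose j1 := Ordinal M1.
have j1E : j1.+1 = M by rewrite /= prednK.
have j01 : (j0 < j1)%N by rewrite /= -ltnS prednK.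
have e0E : \sum_j p j * s j = e0 by apply: eq_bigr => j _; rewrite mulrC.
have s0_le j : s j0 <= s j by exact: s_nondecreasing.
have s1_ge j : s j <= s j1 by apply: s_nondecreasing => //; rewrite -ltnS j1E.
have e_gt : s j0 < e0.
  rewrite -subr_gt0 -[s j0]mul1r -hp1 -e0E mulr_suml -sumrB.
  rewrite (bigD1 j1)//= ltr_pwDl//.
    by rewrite -mulrBr mulr_gt0// subr_gt0 hs.
  by rewrite sumr_ge0// => j _; rewrite -mulrBr mulr_ge0 ?subr_ge0// ltW.
have e_lt : e0 < s j1.
  rewrite -subr_gt0 -[s j1]mul1r -hp1 -e0E mulr_suml -sumrB.
  rewrite (bigD1 j0)//= ltr_pwDl//.
    by rewrite -mulrBr mulr_gt0// subr_gt0 hs.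
  by rewrite sumr_ge0// => j _; rewrite -mulrBr mulr_ge0 ?subr_ge0// ltW.
pose mu : 'rV[R]_M := \row_j jump_prob s e0 j.
have muE g : \sum_j mu 0 j * g j = \sum_j jump_prob s e0 j * g j.
  by apply: eq_bigr => j _; rewrite mxE.
have mu_ge0 j : 0 <= mu 0 j by rewrite mxE; exact: jump_prob_ge0.
have mu_sum1 : \sum_j mu 0 j = 1.
  under eq_bigr do rewrite mxE; exact: (jump_prob_sum1 hs e_gt e_lt).
have mu_mean : \sum_j mu 0 j * s j = e0.
  rewrite muE; exact: (jump_prob_expect hs e_gt e_lt).
have mu_call j : inner j -> mean mu (call_payoff s j) = Num.max (e0 - s j) 0.
  move=> _; rewrite /mean muE; exact: (jump_prob_call hs e_gt e_lt).
(* [l] depends neither on [a] nor on the probability space *)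
have [l [l_gt0 l_ends l_law]] :=
  exists_rates hs (erefl : j0 = 0%N :> nat) j1E j01 mu_ge0 mu_sum1 mu_mean
    mu_call hp hp1 e0E hr.
have l_ge0 j : 0 <= l j.
  by have [/l_gt0/ltW//|/l_ends ->] := boolP (inner j).
have [L L0 lL] : exists2 L : R, 0 < L & forall j, l j <= L.
  exists (1 + \sum_j l j); first by rewrite ltr_pwDl// sumr_ge0.
  by move=> j; rewrite (bigD1 j)//= addrCA lerDl addr_ge0// sumr_ge0.
(* solves [a / (1 - a) = L], the bound that makes all the [q j] at most 1 *)
exists (L / (1 + L)); split.
  have L2 : 0 < 1 + L by rewrite addr_gt0.
  by apply/andP; split; [rewrite divr_ge0// ltW|rewrite ltr_pdivrMr// mul1r ltrDr].
move=> a /andP[aL a1] d T P tau tauE.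
have a0 : 0 < a by apply: lt_le_trans aL; rewrite divr_gt0// addr_gt0.
have La : L * (1 - a) <= a.
  by move: aL; rewrite ler_pdivrMr ?addr_gt0// => aL; lra.
have na0 : 0 < 1 - a by rewrite subr_gt0.
pose q j := l j * (1 - a) / a.
have lq j : l j = a / (1 - a) * q j by rewrite /q; field; rewrite !gt_eqF.
have q01 j : 0 <= q j <= 1.
  rewrite /q divr_ge0 ?mulr_ge0 ?(ltW na0) ?(ltW a0)//= ler_pdivrMr// mul1r.
  by apply: le_trans La; rewrite ler_pM2r.
have q_ends : vanishes_at_ends q by move=> j nj; rewrite /q l_ends// !mul0r.
exists q; split.
  move=> j; split => [ij|nj]; last exact: q_ends.
  by have /andP[_ ->] := q01 j; rewrite andbT /q divr_gt0// mulr_gt0// l_gt0.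
pose U : probability (measurableTypeR R) R := uniform_prob (@ltr01 R).
pose P' : probability (T * measurableTypeR R)%type R := (P \x U)%E.
pose V : T * measurableTypeR R -> R := @clip R \o snd.
have V_range w : 0 <= V w < 1 by exact: clip_range.
have V_meas c : measurable [set w | V w < c].
  exact: (product_source_measurable (v := @clip R) (@clip_measurable R)).
have U_unif (c : R) : 0 <= c <= 1 -> U [set x | clip x < c] = c%:E.
  exact: uniform_clip.
have V_unif (c : R) : 0 <= c <= 1 -> P' [set w | V w < c] = c%:E.
  exact: (product_source_uniform (P := P) (U := U) (v := @clip R) (@clip_measurable R) U_unif).
pose K := dmrw_kernel s q e0.
have K0 : forall z k, 0 <= K z k by move=> z k; exact: dmrw_kernel_ge0.
have K1 : forall z, \sum_k K z k = 1.
  exact: (dmrw_kernel_sum1 hs q_ends e_gt e_lt).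
pose Z := state j0 K V.
have mZ n z : measurable [set w | Z n w = z] by exact: state_measurable.
have [X0 X0E] := rv_of P' (measurable_cst e0 : measurable_fun setT (fun=> e0)).
have /choice[X XE] n : exists X : {RV P' >-> R}, forall w, X w = position s e0 (Z n.+1 w).
  exact: (rv_of P' (finite_valued_measurable_fun (f := Z n.+1) (mZ n.+1) (position s e0))).
have [proj projE] := rv_of P'
  (measurable_fst : measurable_fun setT (@fst T (measurableTypeR R))).
have [tau' tau'E] := rv_of P'
  (measurableT_comp (measurable_funP tau) (measurable_funP proj)).
have tau'fst w : tau' w = tau w.1 by rewrite tau'E/= projE.
have ind : independent_time tau' (with_start X0 X).
  exact: (product_independent (P := P) (U := U) (v := @clip R) hs q01 q_ends
    e_gt e_lt j1E (@clip_range R) (@clip_measurable R) X0E XE tau'fst).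
exists _, _, P', proj, tau', X0, X; split => //.
- move=> A mA; rewrite (_ : proj @^-1` A = fst @^-1` A); first exact: product_fst.
  by apply/seteqP; split => w; rewrite /preimage/= projE.
- exact: (dmrw_process hs q01 q_ends e_gt e_lt j1E V_range V_meas V_unif).
have X0T : [set w | X0 w = e0] = setT by apply/seteqP; split => w //= _; rewrite X0E.
rewrite X0T probability_setT; split; first exact: lte01.
move=> j; rewrite /cond_prob setIT probability_setT divr1.
pose u k := law_at (dmrw_matrix s q) mu k 0 j.
rewrite (@stopped_law _ _ _ P' tau' (with_start X0 X) X (s j) (nbin a r) u (p j))//.
- move=> k; apply: sub_sigma_algebra; exists k.+1 => //.
  by exists [set s j]; [exact: measurable_set1|rewrite setTI].
- move=> k; rewrite (_ : tau' @^-1` [set k] = fst @^-1` (tau @^-1` [set k])).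
    rewrite product_fst; last first.
      by rewrite -[X in measurable X]setTI; exact: measurable_funP.
    rewrite tauE /nbin; congr (_ * _ * _)%:E; congr (_%:R).
    by case: (r) hr.
  by apply/seteqP; split => w; rewrite /preimage/= tau'fst.
- move=> k; rewrite (position_Some hs XE).
  exact: (state_law hs q01 q_ends e_gt e_lt j1E V_range V_meas V_unif).
have NE : (1 - a)^-1 *: (1%:M - a *: dmrw_matrix s q) = resolvent_inv s l.
  rewrite resolvent_invZ ?gt_eqF//; congr resolvent_inv.
  by apply/funext => i; rewrite -lq.
have bnd k i : `|law_at (dmrw_matrix s q) mu k 0 i| <= 1.
  have Pk := state_law hs q01 q_ends e_gt e_lt j1E V_range V_meas V_unif k i.
  by rewrite ger0_norm -lee_fin -Pk// probability_le1.
have := @mixture_cvg R M (dmrw_matrix s q) mu a r j.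
rewrite NE (ltW a0) a1 => /(_ isT (resolvent_inv_unit hs l_ge0 l_ends) bnd).
rewrite -/(law_after s mu l r) l_law; apply: cvg_trans.
rewrite (_ : (fun n => _) = fun n => mixture (dmrw_matrix s q) mu a r n.+1 0 j)//.
apply/funext => n; rewrite /mixture summxE; apply: eq_bigr => k _.
by rewrite mxE.
Qed.
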